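(* The following three classes of computational problems have the same computational power up to polynomial-time conjunctive-equivalence, i.e., for every problem $P$ in any one of the classes there is, in each of the other two classes, a problem that is polynomial-time conjunctive-equivalent to $P$: (1) the problems described by monotone extensional SNP sentences; (2) the problems described by monotone connected extensional SNP sentences; (3) the problems $\mathrm{CSP}(\mathbb B)$ where $\mathbb B$ is a finitely bounded structure. Moreover, classes (2) and (3) have the same computational power up to log-space equivalence: for every problem in one of these two classes there is a log-space equivalent problem in the other.
   Context: All signatures are finite and relational, and all structures have non-empty (possibly infinite) domains. An SNP $\tau$-sentence has the form $\exists R_1,\dots,R_k\,\forall x_1,\dots,x_n.\,\psi$ with $\psi$ a quantifier-free $(\tau\cup\{R_1,\dots,R_k\})$-formula, taken in conjunctive normal form, where $R_1,\dots,R_k\notin\tau$. The problem it describes is the class of finite $\tau$-structures satisfying it. Such a sentence is: - extensional if for every existentially quantified symbol $R$ there is a distinct symbol $R'\in\tau$ of the same arity such that the first-order part contains the clause $R'(\bar x)\Rightarrow R(\bar x)$, and $R'$ does not appear in any other clause; - monotone if every symbol from $\tau\cup\{=\}$ occurs in $\psi$ only in negated literals (without loss of generality, such a sentence does not use equality at all); - connected if $\psi$ contains no positive literal $x=y$ and every clause $C$ of $\psi$ is connected, meaning that the following structure (the canonical database of $C$) is connected: its domain is the set of variables of $C$, and, for each relation symbol $R\in\tau\cup\{R_1,\dots,R_k\}$, a tuple $\bar x$ is in relation $R$ iff $C$ contains the negative literal $\lnot R(\bar x)$. (A structure is connected if it is not the disjoint union of two structures.) $\mathrm{CSP}(\mathbb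 B)$ is the class of finite structures $\mathbb A$ (in the signature of $\mathbb B$) that admit a homomorphism to $\mathbb B$. A structure $\mathbb B$ is finitely bounded if there is a finite set $\mathcal F$ of finite structures such that a finite structure $\mathbb A$ embeds into $\mathbb B$ if and only if no structure from $\mathcal F$ embeds into $\mathbb A$. A polynomial-time conjunctive reduction from $L$ to $L'$ is a polynomial-time computable function $g$ which computes for each $x$ a (finite) set of queries $g(x)$ such that $x\in L$ if and only if $y\in L'$ for all $y\in g(x)$. Problems are polynomial-time conjunctive-equivalent if there are such reductions in both directions. They are log-space equivalent if there are log-space computable many-one reductions in both directions.
   Formalization: In the log-space part, from class (2) to class (3), the problem is assumed to have at least one yes-instance (an unsatisfiable sentence describes the empty problem, which is not many-one equivalent to any CSP); all relation symbols have arity at least one. *)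

(* Defs.v *)
From Stdlib Require List.
From mathcomp Require Import all_boot.

Set Implicit Arguments.
Unset Strict Implicit.
Unset Printing Implicit Defensive.

(** * Relational structures *)

(* Nullary symbols are excluded: "connected" and "disjoint union" are only
   meaningful for structures without them. *)
Record signature := Signature {
  symbol : finType;
  arity : symbol -> nat;
  arity_gt0 : forall R, 0 < arity R }.

(* Non-emptiness of the domain is a separate hypothesis (where it is not
   automatic), because the canonical database of the empty clause has none. *)
Record structure (tau : signature) := Structure {
  domain :> Type;
  interp : forall R : symbol tau, (arity R).-tuple domain -> Prop }.
Arguments interp {tau} s R t.

(* Every finite structure is isomorphic to one with domain {0, ..., n}, and all
   classes of structures considered below are closed under isomorphism. *)
Record finstructure (tau : signature) := FinStructure {
  max_elt : nat;
  table : forall R : symbol tau, {set (arity R).-tuple 'I_max_elt.+1} }.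
Arguments table {tau} f R.

Definition structure_of (tau : signature) (A : finstructure tau) :
  structure tau := @Structure tau _ (fun R t => t \in table A R).
Coercion structure_of : finstructure >-> structure.

Section Maps.
Variables (tau : signature) (A B : structure tau).

Definition homomorphism (h : A -> B) : Prop :=
  forall R t, interp A R t -> interp B R (map_tuple h t).

Definition embedding (h : A -> B) : Prop :=
  injective h /\ forall R t, interp A R t <-> interp B R (map_tuple h t).

Definition isomorphic : Prop := exists h : A -> B, bijective h /\ embedding h.

Definition maps_to : Prop := exists h : A -> B, homomorphism h.

Definition embeds : Prop := exists h : A -> B, embedding h.

Definition disjoint_union : structure tau :=
  @Structure tau (A + B)%type (fun R t =>
    (exists2 s, interp A R s & t = map_tuple inl s) \/
    (exists2 s, interp B R s & t = map_tuple inr s)).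

End Maps.

Definition connected (tau : signature) (A : structure tau) : Prop :=
  ~ exists A1 A2 : structure tau,
      [/\ inhabited A1, inhabited A2 & isomorphic A (disjoint_union A1 A2)].

Definition finitely_bounded (tau : signature) (B : structure tau) : Prop :=
  exists F : seq (finstructure tau), forall A : finstructure tau,
    embeds A B <-> ~ exists2 X, List.In X F & embeds X A.

(** * SNP sentences *)

Lemma sum_arity_gt0 (tau rho : signature) (R : symbol tau + symbol rho) :
  0 < match R with inl R0 => arity R0 | inr R0 => arity R0 end.
Proof. by case: R => R; apply: arity_gt0. Qed.

Definition sum_signature (tau rho : signature) : signature :=
  @Signature (symbol tau + symbol rho)%type _ (@sum_arity_gt0 tau rho).

Section Formulas.
Variables (sigma : signature) (n : nat).

(* [inl (existT R x)] is the atom R(x) and [inr (x, y)] is the atom x = y;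
   variables are elements of ['I_n]. *)
Definition atom : finType :=
  ({R : symbol sigma & (arity R).-tuple 'I_n} + 'I_n * 'I_n)%type.

Definition rel_atom (R : symbol sigma) (x : (arity R).-tuple 'I_n) : atom :=
  inl (existT _ R x).

Definition eq_atom (x y : 'I_n) : atom := inr (x, y).

Definition literal : finType := (bool * atom)%type.

Definition pos (a : atom) : literal := (true, a).
Definition neg (a : atom) : literal := (false, a).

Definition clause : finType := {set literal}.

Definition atom_holds (A : structure sigma) (v : 'I_n -> A) (a : atom) : Prop :=
  match a with
  | inl (existT R x) => interp A R (map_tuple v x)
  | inr (x, y) => v x = v y
  end.

Definition literal_holds (A : structure sigma) (v : 'I_n -> A) (l : literal) :=
  if l.1 then atom_holds v l.2 else ~ atom_holds v l.2.

Definition clause_holds (A : structure sigma) (v : 'I_n -> A) (C : clause) :=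
  exists2 l, l \in C & literal_holds v l.

Definition atom_vars (a : atom) : {set 'I_n} :=
  match a with
  | inl (existT R x) => [set i in x]
  | inr (x, y) => [set x; y]
  end.

Definition clause_vars (C : clause) : {set 'I_n} :=
  \bigcup_(l in C) atom_vars l.2.

Definition canonical_database (C : clause) : structure sigma :=
  @Structure sigma {i : 'I_n | i \in clause_vars C}
    (fun R t => neg (rel_atom (map_tuple val t)) \in C).

End Formulas.

(* The sentence "exists [ex_sig], forall x_0 ... x_(nvars - 1), [matrix]", where
   the matrix is in conjunctive normal form, i.e., a set of clauses. *)
Record snp (tau : signature) := SNP {
  ex_sig : signature;
  nvars : nat;
  matrix : {set clause (sum_signature tau ex_sig) nvars} }.

Definition expansion (tau rho : signature) (A : structure tau)
    (I : forall R : symbol rho, (arity R).-tuple A -> Prop) :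
    structure (sum_signature tau rho) :=
  @Structure (sum_signature tau rho) A (fun R =>
    match R with
    | inl R0 => fun t => interp A R0 t
    | inr R0 => fun t => I R0 t
    end).

Section SNPSentences.
Variables (tau : signature) (Phi : snp tau).

Definition input_atom (R : symbol tau) (x : (arity R).-tuple 'I_(nvars Phi)) :
    atom (sum_signature tau (ex_sig Phi)) (nvars Phi) :=
  @rel_atom (sum_signature tau (ex_sig Phi)) (nvars Phi) (inl R) x.

Definition ex_atom (R : symbol (ex_sig Phi))
    (x : (arity R).-tuple 'I_(nvars Phi)) :
    atom (sum_signature tau (ex_sig Phi)) (nvars Phi) :=
  @rel_atom (sum_signature tau (ex_sig Phi)) (nvars Phi) (inr R) x.

Definition satisfies (A : structure tau) : Prop :=
  exists I : (forall R : symbol (ex_sig Phi), (arity R).-tuple A -> Prop),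
  forall v : 'I_(nvars Phi) -> A, forall C, C \in matrix Phi ->
    @clause_holds _ _ (expansion I) v C.

Definition extensional : Prop :=
  exists prime : symbol (ex_sig Phi) -> symbol tau,
    injective prime /\
    forall R : symbol (ex_sig Phi),
    exists (eq_ar : arity R = arity (prime R))
           (x : (arity R).-tuple 'I_(nvars Phi)),
      let C := [set neg (input_atom (tcast eq_ar x)); pos (ex_atom x)] in
      [/\ uniq x, C \in matrix Phi &
          forall C', C' \in matrix Phi -> C' != C ->
          forall b y, (b, @input_atom (prime R) y) \notin C'].

Definition monotone : Prop :=
  forall C, C \in matrix Phi ->
    (forall R x, pos (@input_atom R x) \notin C) /\
    (forall x y, pos (eq_atom _ x y) \notin C).

Definition connected_snp : Prop :=
  forall C, C \in matrix Phi ->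
    (forall x y, pos (eq_atom _ x y) \notin C) /\
    connected (canonical_database C).

End SNPSentences.

(** * Classes of computational problems *)

Record problem := Problem {
  psig : signature;
  yes : finstructure psig -> Prop }.

Definition monotone_extensional_SNP (P : problem) : Prop :=
  exists Phi : snp (psig P),
    [/\ monotone Phi, extensional Phi &
        forall A, yes A <-> satisfies Phi A].

Definition monotone_connected_extensional_SNP (P : problem) : Prop :=
  exists Phi : snp (psig P),
    [/\ monotone Phi, connected_snp Phi, extensional Phi &
        forall A, yes A <-> satisfies Phi A].

Definition finitely_bounded_CSP (P : problem) : Prop :=
  exists B : structure (psig P),
    [/\ inhabited B, finitely_bounded B &
        forall A : finstructure (psig P), yes A <-> maps_to A B].

(** * Encoding of finite structures as bit strings *)

Fixpoint all_tuples (T : finType) (k : nat) : seq (k.-tuple T) :=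
  match k with
  | 0 => [:: [tuple]]
  | k'.+1 => [seq cons_tuple x t | x <- enum T, t <- all_tuples T k']
  end.

(* The cardinality in unary, a separator, and then the characteristic vector of
   each relation with tuples in lexicographic order. For a fixed signature this
   code is self-delimiting. *)
Definition encode (tau : signature) (A : finstructure tau) : seq bool :=
  nseq (max_elt A).+1 true ++ false ::
  flatten [seq [seq t \in table A R | t <- all_tuples _ (arity R)]
          | R <- enum (symbol tau)].

Definition encode_seq (tau : signature) (s : seq (finstructure tau)) :
    seq bool :=
  flatten [seq true :: encode A | A <- s] ++ [:: false].

(** * Turing machines *)

Inductive move := Left | Stay | Right.

(* A deterministic machine with a read-only two-way input tape, [ntapes] work
   tapes that are infinite to the right, and a write-only output tape. The
   transition function receives the state, the scanned input symbol ([None] for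
   either end marker) and the scanned work symbols. It returns [None] to halt;
   otherwise the new state, the move of the input head, the symbol written and
   the move made on each work tape, and an optional output symbol. *)
Record machine := Machine {
  state : finType;
  ntapes : nat;
  letter : finType;
  blank : letter;
  start : state;
  transition : state -> option bool -> {ffun 'I_ntapes -> letter} ->
    option (state * move * ('I_ntapes -> letter * move) * option bool) }.

Section Runs.
Variables (M : machine) (input : seq bool).

Record config := Config {
  cur_state : state M;
  input_pos : nat;
  content : 'I_(ntapes M) -> nat -> letter M;
  head_pos : 'I_(ntapes M) -> nat;
  output : seq bool }.

Definition init : config :=
  Config (start M) 0 (fun _ _ => blank M) (fun _ => 0) [::].

Definition move_head (m : move) (p : nat) : nat :=
  match m with Left => p.-1 | Stay => p | Right => p.+1 end.

(* The input tape is: end marker, input, end marker. The input head cannot leave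
   this part of the tape. *)
Definition scanned_input (p : nat) : option bool :=
  nth None (None :: rcons (map Some input) None) p.

Definition next (c : config) :=
  transition (cur_state c) (scanned_input (input_pos c))
    [ffun i => content c i (head_pos c i)].

Definition step (c : config) : config :=
  match next c with
  | None => c
  | Some (q, m, w, o) =>
      Config q (minn (move_head m (input_pos c)) (size input).+1)
        (fun i p => if p == head_pos c i then (w i).1 else content c i p)
        (fun i => move_head (w i).2 (head_pos c i))
        (if o is Some b then rcons (output c) b else output c)
  end.

Definition run (t : nat) : config := iter t step init.

Definition outputs_within (t : nat) (w : seq bool) : Prop :=
  next (run t) = None /\ output (run t) = w.

Definition space_below (s : nat) : Prop := forall t i, head_pos (run t) i < s.

End Runs.

Section Computability.
Variables (X Y : Type) (codeX : X -> seq bool) (codeY : Y -> seq bool).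

Definition polytime_computable (f : X -> Y) : Prop :=
  exists (M : machine) (k : nat), forall x : X,
    outputs_within M (codeX x) (size (codeX x) ^ k + k) (codeY (f x)).

Definition logspace_computable (f : X -> Y) : Prop :=
  exists (M : machine) (k : nat), forall x : X,
    (exists t, outputs_within M (codeX x) t (codeY (f x))) /\
    space_below M (codeX x) (k * (trunc_log 2 (size (codeX x))).+1).

End Computability.

(** * Reductions *)

Definition polytime_conjunctive_reduces (P Q : problem) : Prop :=
  exists g : finstructure (psig P) -> seq (finstructure (psig Q)),
    polytime_computable (@encode _) (@encode_seq _) g /\
    forall A, yes A <-> (forall B, List.In B (g A) -> yes B).

Definition logspace_reduces (P Q : problem) : Prop :=
  exists g : finstructure (psig P) -> finstructure (psig Q),
    logspace_computable (@encode _) (@encode _) g /\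
    forall A, yes A <-> yes (g A).

Definition polytime_conjunctive_equivalent (P Q : problem) : Prop :=
  polytime_conjunctive_reduces P Q /\ polytime_conjunctive_reduces Q P.

Definition logspace_equivalent (P Q : problem) : Prop :=
  logspace_reduces P Q /\ logspace_reduces Q P.

(* Same computational power of two classes of problems up to [equiv]. *)
Definition same_power (equiv : problem -> problem -> Prop)
    (K1 K2 : problem -> Prop) : Prop :=
  (forall P, K1 P -> exists Q, K2 Q /\ equiv P Q) /\
  (forall P, K2 P -> exists Q, K1 Q /\ equiv P Q).

(* Main.v *)
From HB Require Import structures.
Require Import Defs.
From mathcomp Require Import all_boot.
From mathcomp Require Import boolp zify.

Set Implicit Arguments.
Unset Strict Implicit.
Unset Printing Implicit Defensive.

(** Both CSPs and sentences are brought into one normal form: an instance is a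
    yes-instance if and only if its relations can be enlarged, on the same
    domain, so that every sample of bounded size (possibly with repetitions)
    gives one of finitely many allowed tables. A monotone extensional sentence
    has this form ([SNP_local]): since R' is included in R, the relation R can
    be stored in place of R', and a clause that fails does so on few elements.
    Conversely, excluding finitely many tables is expressed by clauses without
    equality ([local_SNP]). The CSP of a finitely bounded structure B has this
    form as well: a homomorphism to B enlarges the relations of the instance so
    that it becomes full, i.e., preserves and reflects all relations, and small
    samples decide the existence of a full homomorphism to B
    ([small_samples_suffice]). So these CSPs are described by monotone
    extensional sentences over the same signature.

    If the sentence is connected, then the disjoint union of all its finite
    models is again a model. This structure is finitely bounded by the small
    structures that are no models, and its CSP is the problem described by the
    sentence ([connected_SNP_is_CSP]), provided that there is a yes-instance.

    It remains to replace arbitrary sentences by connected ones. For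
    conjunctive reductions, every symbol gets one more argument, so that an
    instance becomes a family of instances indexed by its elements, all of
    which have to be yes-instances ([family_problem_SNP]). All atoms of a clause
    share the index. This connects the clauses if every variable occurs in a
    negative literal, which is achieved by speaking only of elements that lie
    in tuples: the other elements can be mapped to one of these, because
    monotone problems are closed under inverse homomorphisms. An instance is
    reduced to the constant family, and a family to the list of its members
    ([family_equivalent]).

    For a logarithmic-space reduction there can only be one query. Here the
    clauses are guarded by an equivalence relation that contains the components
    of the instance ([doubled_problem_SNP]); since CSPs are closed under disjoint
    unions, the choice of this relation does not change the answer. Its input
    part is added and removed by the reductions ([doubled_equivalent]).

    The reductions are computed by explicit machines with one work tape. They
    are simple because of the order of the tables in the code of an instance:
    the constant family repeats each bit of the table, a member is a residue
    class of positions, and the equivalence relation is part of a second half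
    that has the same length as the first. Finally, problems without
    yes-instances are described by the empty clause, and they are equivalent to
    a CSP that asks whether a unary relation is empty ([no_yes_equivalent]). *)

(** * Lists and tuples *)

Lemma In_flatten_map (I T : Type) (f : I -> seq T) (s : seq I) x :
  List.In x (flatten (map f s)) <-> exists2 i, List.In i s & List.In x (f i).
Proof.
elim: s => [|i s IH] /=; first by split=> [|[]].
rewrite -/(cat (f i) _) List.in_app_iff IH.
split=> [[fx|[j sj fx]]|[j [<-|sj] fx]].
- by exists i => //; left.
- by exists j => //; right.
- by left.
- by right; exists j.
Qed.

Lemma In_mem (T : eqType) (s : seq T) x : List.In x s <-> x \in s.
Proof.
elim: s => //= y s IH; rewrite inE IH; split=> [[->|->]|/orP[/eqP->|]].
- by rewrite eqxx.
- by rewrite orbT.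
- by left.
- by right.
Qed.

Lemma In_map (I T : Type) (f : I -> T) (s : seq I) x :
  List.In x (map f s) <-> exists2 i, List.In i s & x = f i.
Proof.
elim: s => [|i s IH] /=; first by split=> [|[]].
rewrite IH; split=> [[<-|[j sj ->]]|[j [<-|sj] ->]].
- by exists i => //; left.
- by exists j => //; right.
- by left.
- by right; exists j.
Qed.

Lemma map_tuple_comp n (A B C : Type) (g : B -> C) (f : A -> B)
    (t : n.-tuple A) : map_tuple g (map_tuple f t) = map_tuple (g \o f) t.
Proof. by apply: val_inj; rewrite /= -map_comp. Qed.

Lemma map_tuple_id n (A : Type) (t : n.-tuple A) : map_tuple id t = t.
Proof. by apply: val_inj; rewrite /= map_id. Qed.

Lemma eq_map_tuple n (A B : Type) (f g : A -> B) (t : n.-tuple A) :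
  f =1 g -> map_tuple f t = map_tuple g t.
Proof. by move=> fg; apply: val_inj; apply: eq_map. Qed.

Lemma eq_in_map_tuple n (A : eqType) B (f g : A -> B) (t : n.-tuple A) :
  {in t, f =1 g} -> map_tuple f t = map_tuple g t.
Proof. by move=> fg; apply: val_inj; apply/eq_in_map. Qed.

Lemma map_tuple_tcast m n (e : m = n) (A B : Type) (f : A -> B)
    (t : m.-tuple A) : map_tuple f (tcast e t) = tcast e (map_tuple f t).
Proof. by case: n / e. Qed.

(** * Pulling back structures and clauses *)

Definition relations (tau : signature) (D : Type) :=
  forall R : symbol tau, (arity R).-tuple D -> Prop.

(** Like an embedding, but possibly not injective: relations are reflected. *)
Definition full_hom (tau : signature) (A B : structure tau) (h : A -> B) :=
  forall R t, interp A R t <-> interp B R (map_tuple h t).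

Definition pullback (tau : signature) (D : Type) (B : structure tau)
    (f : D -> B) : structure tau :=
  @Structure tau D (fun R t => interp B R (map_tuple f t)).

Definition no_pos_eq (sigma : signature) n (C : clause sigma n) :=
  forall x y, pos (eq_atom _ x y) \notin C.

Lemma clause_failsP (sigma : signature) n (A : structure sigma)
    (v : 'I_n -> A) (C : clause sigma n) :
  ~ clause_holds v C <->
  forall b a, (b, a) \in C -> if b then ~ atom_holds v a else atom_holds v a.
Proof.
split=> [nC b a Ca | H [[b a] Ca]].
  have nl : ~ literal_holds v (b, a) by move=> hl; apply: nC; exists (b, a).
  by case: b Ca nl => // Ca nl; apply: contrapT.
by have := H b a Ca; rewrite /literal_holds /=; case: b {Ca}.
Qed.

(** Equality may only be negated, so that identifying elements can only make
    literals false: a clause that holds at the image of an assignment holds at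
    the assignment itself. *)
Lemma clause_holds_full (sigma : signature) n (A B : structure sigma)
    (h : A -> B) (v : 'I_n -> A) (C : clause sigma n) :
  full_hom h -> no_pos_eq C -> clause_holds (h \o v) C -> clause_holds v C.
Proof.
move=> full noeq [[b a] Ca]; rewrite /literal_holds /= => hl; exists (b, a) => //.
rewrite /literal_holds /=.
case: a Ca hl => [[R x]|[x y]] Ca; case: b Ca => Ca /=.
- by rewrite full map_tuple_comp.
- by rewrite full map_tuple_comp.
- by have := noeq x y; rewrite Ca.
- by move=> hxy vxy; apply: hxy; rewrite vxy.
Qed.

(** The existential relations are pulled back along the homomorphism. The input
    relations lie inside the pulled-back ones, and they only occur negated. *)
Lemma maps_to_satisfies (tau : signature) (Phi : snp tau) (A B : structure tau) :
  monotone Phi -> maps_to A B -> satisfies Phi B -> satisfies Phi A.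
Proof.
move=> mono [h hom] [I HI]; exists (fun R t => I R (map_tuple h t)) => v C CM.
have [[b a] Ca hl] := HI (h \o v) C CM; exists (b, a) => //.
have [mR mE] := mono C CM.
move: hl; rewrite /literal_holds /=.
case: a Ca => [[[R|R] x]|[x y]] /= Ca; case: b Ca => Ca /=.
- by have := mR R x; rewrite Ca.
- by move=> nB Ax; apply: nB; rewrite -map_tuple_comp; apply: hom.
- by rewrite map_tuple_comp.
- by rewrite map_tuple_comp.
- by have := mE x y; rewrite Ca.
- by move=> hxy vxy; apply: hxy; rewrite vxy.
Qed.

(** * Absorbing the existential relations into the input relations *)

Section Absorption.
Variables (tau : signature) (Phi : snp tau).
Variable prime : symbol (ex_sig Phi) -> symbol tau.
Hypothesis prime_arity : forall R, arity R = arity (prime R).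

(** Since R' is included in R, a satisfying expansion can be stored in the
    input relations alone: R' is enlarged to R. A model is a structure that
    satisfies the clauses when R is read off from R'. *)
Definition prime_rels (S : structure tau) : relations (ex_sig Phi) S :=
  fun R t => interp S (prime R) (tcast (prime_arity R) t).

Definition is_model (S : structure tau) := forall v C, C \in matrix Phi ->
  @clause_holds _ (nvars Phi) (expansion (@prime_rels S)) v C.

Lemma is_model_satisfies (S : structure tau) : is_model S -> satisfies Phi S.
Proof. by move=> HS; exists (@prime_rels S). Qed.

Lemma full_hom_expansion (A B : structure tau) (h : A -> B) :
  full_hom h -> @full_hom _ (expansion (@prime_rels A))
                           (expansion (@prime_rels B)) h.
Proof. by move=> full [R|R] t //=; rewrite /prime_rels full map_tuple_tcast. Qed.

Lemma is_model_full (A B : structure tau) (h : A -> B) :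
  monotone Phi -> full_hom h -> is_model B -> is_model A.
Proof.
move=> mono full HB v C CM.
apply: (clause_holds_full (full_hom_expansion full)); last exact: HB.
by case: (mono C CM).
Qed.

Hypothesis prime_inj : injective prime.
Hypothesis prime_ext : forall R, exists x : (arity R).-tuple 'I_(nvars Phi),
  let C := [set neg (input_atom (tcast (prime_arity R) x)); pos (ex_atom x)] in
  [/\ uniq x, C \in matrix Phi &
      forall C', C' \in matrix Phi -> C' != C ->
      forall b y, (b, @input_atom _ Phi (prime R) y) \notin C'].

(** The variables of an extension clause are distinct, so that they can be
    assigned an arbitrary tuple. *)
Lemma extension_holds (A : structure tau) (I : relations (ex_sig Phi) A) :
  (forall v C, C \in matrix Phi ->
     @clause_holds _ (nvars Phi) (expansion I) v C) ->
  forall R t, interp A (prime R) (tcast (prime_arity R) t) -> I R t.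
Proof.
move=> HI R t At; have [x [ux CM _]] := prime_ext R.
have a0 : A by case: t {At}; case: (arity R) (arity_gt0 R) => // k _ [] // a.
pose v j := nth a0 t (index j x).
have vx : map_tuple v x = t.
  apply: val_inj; apply: (@eq_from_nth _ a0); first by rewrite size_map !size_tuple.
  move=> i; rewrite size_map => ltix; rewrite (nth_map (tnth x (Ordinal (arity_gt0 R)))) //.
  by rewrite /v index_uniq.
have [l] := HI v _ CM; rewrite !inE => /orP[] /eqP->; rewrite /literal_holds /=.
  by rewrite map_tuple_tcast vx.
by rewrite vx.
Qed.

(** Clauses mentioning a primed symbol are the extension clauses, which hold as
    soon as R and R' are interpreted alike; every other input symbol keeps its
    interpretation. *)
Lemma satisfies_model (A : structure tau) : monotone Phi ->
  satisfies Phi A <-> exists I : relations tau A,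
    (forall R t, interp A R t -> I R t) /\ is_model (Structure I).
Proof.
move=> mono; split=> [[I HI]|[J [AJ HJ]]]; last first.
  apply: (maps_to_satisfies (B := Structure J)) => //; last exact: is_model_satisfies.
  by exists id => R t At; rewrite map_tuple_id; apply: AJ.
have ext := extension_holds HI.
(* The symbol R' is recognized by an equality of dependent pairs, since the
   arities of R and R' are only propositionally equal. *)
pose J : relations tau A := fun Q t => interp A Q t \/
  exists R (s : (arity R).-tuple A),
    existT (fun Q => (arity Q).-tuple A) (prime R) (tcast (prime_arity R) s)
      = existT _ Q t /\ I R s.
have JI R s : J (prime R) (tcast (prime_arity R) s) <-> I R s.
  split=> [[/ext //|[R' [s' [eqs Is']]]] | Is]; last by right; exists R, s.
  have /prime_inj eR := congr1 tag eqs; subst R'.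
  suff -> : s = s' by [].
  by have /(congr1 (@tval _ _)) := existT_inj2 eqs; rewrite !val_tcast => /val_inj.
exists J; split=> [R t At|v C CM]; first by left.
have [[R CR]|noR] := pselect (exists R, exists b y,
    (b, @input_atom _ Phi (prime R) y) \in C).
  have [x [_ _ only]] := prime_ext R.
  have eC : C == [set neg (input_atom (tcast (prime_arity R) x)); pos (ex_atom x)].
    by apply: contraT => neC; have [b [y]] := CR; rewrite (negPf (only _ CM neC b y)).
  have [Jx|nJx] := pselect (I R (map_tuple v x)).
    exists (pos (ex_atom x)); first by rewrite (eqP eC) !inE eqxx orbT.
    by rewrite /literal_holds /= /prime_rels /= JI.
  exists (neg (input_atom (tcast (prime_arity R) x))).
    by rewrite (eqP eC) !inE eqxx.
  by rewrite /literal_holds /= map_tuple_tcast JI.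
have [[b a] Ca hl] := HI v C CM; exists (b, a) => //; move: hl.
rewrite /literal_holds /=; case: a Ca => [[[Q|R] x]|[x y]] //= Ca.
  suff -> : interp A Q (map_tuple v x) = J Q (map_tuple v x) by [].
  apply: propext; split=> [|[//|[R [s [/(congr1 tag)/= eQ _]]]]]; first by left.
  by subst Q; case: noR; exists R, b, x.
by rewrite /prime_rels /=; case: b {Ca}; rewrite JI.
Qed.

End Absorption.

Lemma extensionalP (tau : signature) (Phi : snp tau) : extensional Phi ->
  exists (prime : symbol (ex_sig Phi) -> symbol tau)
         (e : forall R, arity R = arity (prime R)),
  injective prime /\
  forall R, exists x : (arity R).-tuple 'I_(nvars Phi),
    let C := [set neg (input_atom (tcast (e R) x)); pos (ex_atom x)] in
    [/\ uniq x, C \in matrix Phi &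
        forall C', C' \in matrix Phi -> C' != C ->
        forall b y, (b, @input_atom _ Phi (prime R) y) \notin C'].
Proof.
move=> [prime [inj H]]; exists prime.
have e R : arity R = arity (prime R) by case: (H R).
exists e; split=> // R; have [e' [x Hx]] := H R; exists x.
by rewrite (eq_irrelevance (e R) e').
Qed.

(** * Connectedness *)

Section Connectedness.
Variables (tau : signature) (A : structure tau).

(** A set of elements that no tuple enters or leaves; a structure is connected
    when every such set is trivial. *)
Definition tuplewise_constant (P : pred A) :=
  forall R t, interp A R t -> forall i j, P (tnth t i) -> P (tnth t j).

Lemma connected_split (P : pred A) (x y : A) : connected A ->
  tuplewise_constant P -> P x -> P y.
Proof.
move=> conA cP Px; apply: contraT => nPy; exfalso; apply: conA.
pose A1 := @pullback tau {a | P a} A val.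
pose A2 := @pullback tau {a | ~~ P a} A val.
pose f1 a : A1 := insubd (exist _ x Px : {a | P a}) a.
pose f2 a : A2 := insubd (exist _ y nPy : {a | ~~ P a}) a.
have f1K a : P a -> val (f1 a) = a by move=> Pa; rewrite /f1 /insubd insubT.
have f2K a : ~~ P a -> val (f2 a) = a by move=> Pa; rewrite /f2 /insubd insubT.
pose h a : A1 + A2 := if P a then inl (f1 a) else inr (f2 a).
pose g (u : A1 + A2) : A := match u with inl b => val b | inr b => val b end.
have hK : cancel h g.
  by move=> a; rewrite /h; case: ifPn => Pa /=; [apply: f1K | apply: f2K].
have gK : cancel g h.
  by case=> [[a Pa]|[a Pa]]; rewrite /h /=; [rewrite Pa | rewrite (negPf Pa)];
     congr (_ _); apply: val_inj; rewrite /= ?f1K ?f2K.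
exists A1, A2; split; [exact: (inhabits (exist _ x Px : A1)) |
  exact: (inhabits (exist _ y nPy : A2)) |].
exists h; split; first by exists g.
split; first exact: can_inj hK.
move=> R t; split=> [At|].
  have i0 := Ordinal (arity_gt0 R).
  have [Pi|nPi] := boolP (P (tnth t i0)).
    have Pt j : P (tnth t j) := cP R t At i0 j Pi.
    left; exists (map_tuple f1 t).
      rewrite /= map_tuple_comp (_ : map_tuple _ t = t) //.
      by apply: eq_from_tnth => j; rewrite tnth_map /= f1K.
    by apply: eq_from_tnth => j; rewrite !tnth_map /h Pt.
  have Pt j : ~~ P (tnth t j) by apply: contra nPi; apply: cP.
  right; exists (map_tuple f2 t).
    rewrite /= map_tuple_comp (_ : map_tuple _ t = t) //.
    by apply: eq_from_tnth => j; rewrite tnth_map /= f2K.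
  by apply: eq_from_tnth => j; rewrite !tnth_map /h (negPf (Pt j)).
rewrite -[X in _ -> interp _ _ X]map_tuple_id -(eq_map_tuple _ hK).
by rewrite -map_tuple_comp => -[] [s As ->]; rewrite map_tuple_comp.
Qed.

Lemma split_connected : (forall (P : pred A) (x y : A),
  tuplewise_constant P -> P x -> P y) -> connected A.
Proof.
move=> H [A1 [A2 [[a1] [a2] [h [[g hK gK] [hinj hrel]]]]]].
pose P a := if h a is inl _ then true else false.
suff : P (g (inr a2)) by rewrite /P gK.
apply: (H P (g (inl a1))); last by rewrite /P gK.
move=> R t /hrel ht i j.
have PE k : P (tnth t k) =
    if tnth (map_tuple h t) k is inl _ then true else false by rewrite tnth_map.
rewrite !PE; move: (map_tuple h t) ht => u /= [] [s _ ->]; by rewrite !tnth_map.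
Qed.

End Connectedness.

(** The connectedness of the canonical database, as a property of the literals
    themselves. *)
Definition linked (sigma : signature) n (C : clause sigma n) :=
  forall P : pred 'I_n,
  (forall R x, neg (@rel_atom sigma n R x) \in C -> forall i j,
     P (tnth x i) -> P (tnth x j)) ->
  {in clause_vars C &, forall i j, P i -> P j}.

Lemma linked_connected (sigma : signature) n (C : clause sigma n) :
  linked C <-> connected (canonical_database C).
Proof.
split=> [lC|conC P cP i j Vi Vj Pi].
  apply: split_connected => P [i Vi] [j Vj] cP Pi.
  pose Q k := if insub k is Some u then P u else false.
  have QE k (Vk : k \in clause_vars C) : Q k = P (exist _ k Vk).
    by rewrite /Q insubT.
  rewrite -QE in Pi; rewrite -QE; apply: (lC Q) Pi => //= R x Cx p q.
  have Vx k : tnth x k \in clause_vars C.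
    apply/bigcupP; exists (neg (@rel_atom sigma n R x)) => //=.
    by rewrite inE mem_tnth.
  rewrite !QE; set a := exist _ _ _; set b := exist _ _ _.
  pose t : (arity R).-tuple (canonical_database C) :=
    [tuple exist (fun i => i \in clause_vars C) (tnth x k) (Vx k) | k < arity R].
  have := cP R t; rewrite /= (_ : map_tuple val t = x); last first.
    by apply: eq_from_tnth => k; rewrite tnth_map tnth_mktuple.
  by move=> /(_ Cx p q); rewrite !tnth_mktuple.
pose Q (u : canonical_database C) := P (val (u : {i | i \in clause_vars C})).
apply: (@connected_split _ _ Q (exist _ i Vi) (exist _ j Vj) conC) => // R t.
by move=> /cP H p q; have := H p q; rewrite !tnth_map.
Qed.

(** All constructed clauses have a variable that shares a negative literal with
    every other one. *)
Lemma linked_star (sigma : signature) n (C : clause sigma n) (c : 'I_n) :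
  {in clause_vars C, forall x, x = c \/ exists R t,
     [/\ neg (@rel_atom sigma n R t) \in C, c \in t & x \in t]} ->
  linked C.
Proof.
move=> star P cP i j Vi Vj.
have same R t x y : neg (@rel_atom sigma n R t) \in C -> x \in t -> y \in t ->
    P x -> P y.
  by move=> Ct /tnthP[p ->] /tnthP[q ->]; apply: cP Ct _ _.
have toc : P i -> P c.
  by case: (star i Vi) => [->|[R [t [Ct ct it]]]] //; apply: same Ct it ct.
have ofc : P c -> P j.
  by case: (star j Vj) => [->|[R [t [Ct ct jt]]]] //; apply: same Ct ct jt.
by move/toc/ofc.
Qed.

(** * Tables *)

(** A finite type that has every structure with domain ['I_m.+1] up to
    extensionality of its relations. *)
Definition tables (tau : signature) (m : nat) : finType :=
  {dffun forall R : symbol tau, {set (arity R).-tuple 'I_m.+1}}.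

Definition of_tables (tau : signature) m (Y : tables tau m) : finstructure tau :=
  @FinStructure tau m (fun R => Y R).

(** The structure on the index set that makes [v], possibly with repetitions, a
    full homomorphism. *)
Definition sample (tau : signature) m (S : structure tau) (v : 'I_m.+1 -> S) :
    tables tau m :=
  [ffun R => [set t | `[< interp S R (map_tuple v t) >]]].

Lemma in_sample (tau : signature) m (S : structure tau) (v : 'I_m.+1 -> S) R t :
  (t \in sample v R) = `[< interp S R (map_tuple v t) >].
Proof. by rewrite ffunE inE. Qed.

Lemma sample_full (tau : signature) m (S : structure tau) (v : 'I_m.+1 -> S) :
  @full_hom tau (of_tables (sample v)) S v.
Proof. by move=> R t /=; rewrite in_sample asboolE. Qed.

Lemma eq_tables (tau : signature) m (Y Z : tables tau m) :
  (forall R t, (t \in Y R) = (t \in Z R)) -> Y = Z.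
Proof. by move=> YZ; apply/ffunP => R; apply/setP => t; apply: YZ. Qed.

Lemma sample_comp (tau : signature) m p (S : structure tau) (v : 'I_m.+1 -> S)
    (w : 'I_p.+1 -> 'I_m.+1) :
  @sample tau p (of_tables (sample v)) w = sample (v \o w).
Proof.
by apply: eq_tables => R t; rewrite !in_sample /= in_sample asboolb map_tuple_comp.
Qed.

Lemma eq_sample (tau : signature) m (S : structure tau) (v w : 'I_m.+1 -> S) :
  v =1 w -> sample v = sample w.
Proof.
by move=> vw; apply: eq_tables => R t; rewrite !in_sample (eq_map_tuple _ vw).
Qed.

Lemma sample_pullback (tau : signature) m (D : Type) (S : structure tau)
    (f : D -> S) (v : 'I_m.+1 -> D) :
  @sample tau m (pullback f) v = sample (f \o v).
Proof. by apply: eq_tables => R t; rewrite !in_sample /= map_tuple_comp. Qed.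

(** Every small nonempty set of elements is the range of some sample [v]; the
    section [j] finds an index for each element. *)
Lemma enumerate_seq (T : eqType) m (x0 : T) (s : seq T) :
  x0 \in s -> size s <= m.+1 ->
  exists (v : 'I_m.+1 -> T) (j : T -> 'I_m.+1),
    (forall i, v i \in s) /\ {in s, cancel j v}.
Proof.
move=> sx0 ls; exists (fun i => nth x0 s i), (fun z => inord (index z s)).
split=> [i|z sz].
  have [lis|] := ltnP i (size s); first exact: mem_nth.
  by move/(nth_default x0) ->.
by rewrite inordK ?nth_index // (leq_trans _ ls) // index_mem.
Qed.

Definition with_relations (tau : signature) (A : finstructure tau)
    (I : relations tau A) : finstructure tau :=
  @FinStructure tau (max_elt A) (fun R => [set t | `[< I R t >]]).

Lemma with_relations_full (tau : signature) (A : finstructure tau)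
    (I : relations tau A) : @full_hom tau (with_relations I) (Structure I) id.
Proof. by move=> R t; rewrite map_tuple_id /= inE asboolE. Qed.

(** * Monotone connected extensional sentences describe CSPs *)

Section ConnectedToCSP.
Variables (tau : signature) (Phi : snp tau).
Hypotheses (mono : monotone Phi) (conn : connected_snp Phi).
Variable prime : symbol (ex_sig Phi) -> symbol tau.
Hypothesis prime_arity : forall R, arity R = arity (prime R).
Notation is_model := (@is_model tau Phi prime prime_arity).

(** The disjoint union of all finite models. The element [(S, k)] stands for the
    element [k] of [S], and for a copy of its element 0 when [k] is too large;
    these copies keep the domain free of dependent types. *)
Definition models_union : structure tau :=
  @Structure tau ({S : finstructure tau | is_model S} * nat)%type
    (fun R t => exists S : {S : finstructure tau | is_model S},
       (forall i, (tnth t i).1 = S) /\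
       map_tuple (fun u => inord u.2) t \in table (sval S) R).

Lemma model_embeds (A : finstructure tau) :
  is_model A -> embeds A models_union.
Proof.
move=> HA; exists (fun a : A => (exist _ A HA : {S : finstructure tau | is_model S}, val a)).
split=> [a b [] /val_inj //|R t].
have E : map_tuple (fun u : {S : finstructure tau | is_model S} * nat => inord u.2)
    (map_tuple (fun a : A => (exist _ A HA : {S : finstructure tau | is_model S}, val a)) t) = t.
  by apply: eq_from_tnth => i; rewrite !tnth_map /= inord_val.
split=> [At|].
  exists (exist _ A HA); split=> [i|]; first by rewrite tnth_map.
  by rewrite E.
case=> S [HS]; have := HS (Ordinal (arity_gt0 R)); rewrite tnth_map /= => <- /=.
by rewrite E.
Qed.

(** If a clause failed, its negative literals would hold in the disjoint union;
    since they connect its variables, all of these would lie in one model [S],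
    where the clause would fail as well. *)
Lemma models_union_model : inhabited models_union -> is_model models_union.
Proof.
move=> [[S0 k0]] v C CM; apply: contrapT => nC.
have {}nC b a (Ca : (b, a) \in C) := (clause_failsP _ _).1 nC b a Ca.
have [noeq /linked_connected lC] := conn CM.
have [S HS] : exists S : {S : finstructure tau | is_model S},
    {in clause_vars C, forall i, (v i).1 = S}.
  have [->|[i0 Vi0]] := set_0Vmem (clause_vars C).
    by exists S0 => i; rewrite inE.
  exists (v i0).1 => i Vi; apply/asboolP.
  apply: (lC (fun i => `[< (v i).1 = (v i0).1 >]) _ i0 i) => //; last exact/asboolP.
  move=> R x Cx p q; have := nC _ _ Cx.
  have same (T : {S : finstructure tau | is_model S})
      (k : nat) (y : k.-tuple 'I_(nvars Phi)) r s :
      (forall r, (tnth (map_tuple v y) r).1 = T) ->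
      (v (tnth y r)).1 = (v i0).1 -> (v (tnth y s)).1 = (v i0).1.
    by move=> E <-; have:= E r; have := E s; rewrite !tnth_map => -> ->.
  case: R x Cx p q => R x Cx p q /= [T [HT _]] /asboolP E; apply/asboolP.
    exact: same HT E.
  apply: (same T _ x p) E => r; have := HT (cast_ord (prime_arity R) r).
  by rewrite tcastE cast_ordK.
(* Variables that do not occur in the clause may take any value in [S]. *)
pose w i : sval S := inord (v i).2.
have wv R x : (forall i, tnth x i \in clause_vars C) ->
    interp models_union R (map_tuple v x) <-> interp (sval S) R (map_tuple w x).
  move=> Vx; split=> [[T [HT]]|Rx].
    have := HT (Ordinal (arity_gt0 R)); rewrite tnth_map HS // => <-.
    by rewrite map_tuple_comp.
  exists S; split=> [i|]; first by rewrite tnth_map HS.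
  by rewrite map_tuple_comp.
have [[b a] Ca hl] := proj2_sig S w C CM.
have inV R y : a = @rel_atom _ _ R y -> forall i, tnth y i \in clause_vars C.
  move=> ea i; apply/bigcupP; exists (b, a) => //=; by rewrite ea inE mem_tnth.
have := nC b a Ca; move: hl; rewrite /literal_holds /=.
case: a Ca inV => [[[R|R] x]|[x y]] /= Ca inV.
- have := wv R x (inV _ _ (erefl _)).
  by case: b Ca {inV} => Ca E; [move=> /E h /(_ h) | move=> h /E].
- have Vx i : tnth (tcast (prime_arity R) x) i \in clause_vars C.
    by rewrite tcastE; apply: (inV _ _ (erefl _)).
  have := wv _ _ Vx; rewrite /prime_rels /= -!map_tuple_tcast.
  by case: b Ca {inV} => Ca E; [move=> /E h /(_ h) | move=> h /E].
- case: b Ca {inV} => Ca; first by have := noeq x y; rewrite Ca.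
  by move=> nw vxy; apply: nw; rewrite /w vxy.
Qed.

(** A structure that is no model has a clause failing at some assignment, whose
    range has at most [nvars] elements. *)
Lemma small_nonmodel (A : finstructure tau) : ~ is_model A ->
  exists m (Y : tables tau m),
    [/\ m <= nvars Phi, ~ is_model (of_tables Y) & embeds (of_tables Y) A].
Proof.
move=> nA; have [v [C CM nC]] : exists v, exists2 C, C \in matrix Phi &
    ~ @clause_holds _ (nvars Phi) (expansion (@prime_rels _ _ _ prime_arity A)) v C.
  apply: contrapT => H; apply: nA => v C CM; apply: contrapT => nC.
  by apply: H; exists v, C.
(* The element 0 is added because the clause may have no variables at all. *)
pose D : {set 'I_(max_elt A).+1} := ord0 |: [set v i | i : 'I_(nvars Phi)].
have D0 : ord0 \in D by rewrite !inE eqxx.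
have cD : #|D|.-1.+1 = #|D| by apply: prednK; apply/card_gt0P; exists ord0.
pose f (i : 'I_(#|D|.-1.+1)) : A := enum_val (cast_ord cD i).
have f_inj : injective f by move=> i j /enum_val_inj /cast_ord_inj.
exists #|D|.-1, (sample f); split.
- rewrite -ltnS cD (leq_trans (leq_card_setU _ _)) //= cards1 ltnS.
  by rewrite (leq_trans (leq_imset_card _ _)) // card_ord.
- move=> HY; apply: nC.
  pose w i := cast_ord (esym cD) (enum_rank_in D0 (v i)).
  have fw i : f (w i) = v i.
    rewrite /f /w cast_ordKV enum_rankK_in //.
    by rewrite !inE imset_f ?orbT.
  have [[b a] Ca hl] := HY w C CM; exists (b, a) => //; move: hl.
  have full := @full_hom_expansion _ _ _ prime_arity _ _ _ (@sample_full _ _ A f).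
  rewrite /literal_holds /=; case: a Ca => [[R x]|[x y]] Ca.
    have fwE : map_tuple v x = map_tuple f (map_tuple w x).
      by rewrite map_tuple_comp; apply: eq_map_tuple => i; rewrite /= fw.
    have F := full R (map_tuple w x).
    by case: b Ca => Ca /=; rewrite fwE; [move/F | move=> n /F].
  case: b Ca => Ca /=; rewrite -!fw; first by move->.
  by move=> nw /f_inj.
- by exists f; split=> //; apply: sample_full.
Qed.

Definition small_nonmodels : seq (finstructure tau) :=
  flatten [seq [seq of_tables Y | Y <- enum (tables tau m) & `[< ~ is_model (of_tables Y) >]]
          | m <- iota 0 (nvars Phi).+1].

Lemma In_small_nonmodels X : List.In X small_nonmodels <->
  exists m (Y : tables tau m),
    [/\ m <= nvars Phi, ~ is_model (of_tables Y) & X = of_tables Y].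
Proof.
rewrite In_flatten_map; split=> [[m /In_mem]|[m [Y [lm nY ->]]]].
  rewrite mem_iota /= add0n ltnS => lm /In_map[Y /In_mem].
  by rewrite mem_filter => /andP[/asboolP nY _] ->; exists m, Y.
exists m; first by apply/In_mem; rewrite mem_iota /= add0n ltnS.
apply/In_map; exists Y => //; apply/In_mem; rewrite mem_filter mem_enum andbT.
exact/asboolP.
Qed.

Lemma models_union_bounded :
  inhabited models_union -> finitely_bounded models_union.
Proof.
move=> /models_union_model HB; exists small_nonmodels => A; split.
  move=> [h [_ hfull]] [X /In_small_nonmodels[m [Y [_ nY ->]]] [g [_ gfull]]].
  apply: nY; apply: (is_model_full mono gfull).
  exact: (is_model_full mono hfull).
move=> noX; apply: model_embeds; apply: contrapT => /small_nonmodel.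
move=> [m [Y [lm nY eY]]]; apply: noX; exists (of_tables Y) => //.
by apply/In_small_nonmodels; exists m, Y.
Qed.

End ConnectedToCSP.

(** A yes-instance maps to a finite model, which is a summand of the universal
    structure; conversely the universal structure is a model. The yes-instance
    in the hypothesis makes the universal structure nonempty. *)
Lemma connected_SNP_is_CSP (P : problem) :
  monotone_connected_extensional_SNP P -> (exists A, @yes P A) ->
  finitely_bounded_CSP P.
Proof.
move=> [Phi [mono conn /extensionalP[prime [e [inj ext]]] yesE]] [A0 yA0].
have satE := fun A => satisfies_model inj ext A mono.
have finE (A : finstructure (psig P)) (I : relations (psig P) A) :
    is_model e (Structure I) -> is_model e (with_relations I).
  exact: (@is_model_full _ _ _ e _ _ _ mono (@with_relations_full _ A I)).
have inh : inhabited (models_union e).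
  have /yesE/satE[I [_ /finE HI]] := yA0.
  by have [h _] := model_embeds HI; exact: (inhabits (h ord0)).
exists (models_union e); split=> // [|A]; first exact: models_union_bounded.
split=> [/yesE/satE[I [AI /finE HI]]|AB]; last first.
  apply/yesE/(maps_to_satisfies mono AB).
  exact/is_model_satisfies/models_union_model.
have [h [_ hfull]] := model_embeds HI; exists h => R t At.
by apply/hfull; rewrite /= inE; apply/asboolP/AI.
Qed.

(** * Local problems *)

(** The problems to be considered ask for an enlargement of the input relations
    whose samples of size [m.+1] all lie in a fixed finite set of tables. *)
Definition extends (tau : signature) (A : structure tau)
    (I : relations tau A) := forall R t, interp A R t -> I R t.

Definition locally_in (tau : signature) m (Y : {set tables tau m})
    (S : structure tau) := forall v : 'I_m.+1 -> S, sample v \in Y.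

Definition local_by (P : problem) m (Y : {set tables (psig P) m}) :=
  forall A : finstructure (psig P),
    yes A <-> exists I : relations (psig P) A,
      extends I /\ locally_in Y (Structure I).

(** Whether a structure is a model can be read off from its samples, as a clause
    that fails does so on few elements. *)
Lemma SNP_local (P : problem) : monotone_extensional_SNP P ->
  exists m (Y : {set tables (psig P) m}), local_by Y.
Proof.
move=> [Phi [mono /extensionalP[prime [e [inj ext]]] yesE]].
exists (nvars Phi), [set Y | `[< is_model e (of_tables Y) >]] => A.
rewrite yesE (satisfies_model inj ext A mono).
pose full_model A B h := @is_model_full _ _ _ e A B h mono.
split=> -[I [AI HI]]; exists I; split=> //.
  move=> v; rewrite inE; apply/asboolP.
  exact: (full_model _ _ _ (@sample_full _ _ _ v) HI).
suff: is_model e (with_relations I).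
  apply: (full_model (Structure I) (with_relations I) id) => R t.
  by rewrite map_tuple_id /= inE asboolE.
apply: contrapT => /small_nonmodel[m [Y [lm nY [g [_ gfull]]]]]; apply: nY.
pose v (i : 'I_(nvars Phi).+1) : A := g (inord i).
pose wid : 'I_m.+1 -> 'I_(nvars Phi).+1 := widen_ord (lm : m.+1 <= (nvars Phi).+1).
have := HI v; rewrite inE => /asboolP.
apply: (full_model (of_tables Y) (of_tables (@sample _ _ (Structure I) v)) wid) => R t.
rewrite /= in_sample asboolE map_tuple_comp (eq_map_tuple (g := g)); last first.
  by move=> i; rewrite /v /= inord_val.
by have := gfull R t; rewrite /= inE asboolE.
Qed.

(** * Sentences built from universal clauses *)

(** Every input symbol R' gets an existential copy R, which is constrained by
    the clauses in [W] in addition to the extension clause. *)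
Section Builder.
Variables (tau : signature) (n : nat) (W : {set clause tau n.+1}).

Definition lift_atom (a : atom tau n.+1) : atom (sum_signature tau tau) n.+1 :=
  match a with
  | inl (existT R x) => @rel_atom (sum_signature tau tau) n.+1 (inr R) x
  | inr (x, y) => eq_atom _ x y
  end.

Definition lift_clause (C : clause tau n.+1) :
    clause (sum_signature tau tau) n.+1 := [set (l.1, lift_atom l.2) | l in C].

Definition first_vars k : k.-tuple 'I_n.+1 := [tuple inord i | i < k].

Definition extension_clause (R : symbol tau) :
    clause (sum_signature tau tau) n.+1 :=
  [set neg (@rel_atom (sum_signature tau tau) n.+1 (inl R) (first_vars (arity R)));
       pos (@rel_atom (sum_signature tau tau) n.+1 (inr R) (first_vars (arity R)))].

Definition built : snp tau := @SNP tau tau n.+1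
  ([set lift_clause C | C in W] :|: [set extension_clause R | R in symbol tau]).

Lemma in_built C : C \in matrix built ->
  (exists2 D, D \in W & C = lift_clause D) \/ exists R, C = extension_clause R.
Proof. by rewrite inE => /orP[/imsetP|/imsetP[R _ ->]]; [left | right; exists R]. Qed.

Lemma in_lift_clause b a C : (b, a) \in lift_clause C ->
  exists2 a', (b, a') \in C & a = lift_atom a'.
Proof. by case/imsetP => -[b' a'] Ca' [-> ->]; exists a'. Qed.

Lemma built_monotone : {in W, forall C, no_pos_eq C} -> monotone built.
Proof.
move=> noeq C /in_built[[D WD ->]|[R ->]].
  split=> [R x|x y]; apply/negP => /in_lift_clause[[[R' x']|[x' y']] Da' //= E].
  by have := noeq D WD x' y'; rewrite Da'.
by split=> [Q x|x y]; apply/negP; rewrite !inE => /orP[] /eqP.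
Qed.

Lemma lift_linked C : linked C -> linked (lift_clause C).
Proof.
move=> lC P cP i j; have vars k : k \in clause_vars (lift_clause C) -> k \in clause_vars C.
  case/bigcupP => -[b a] /in_lift_clause[a' Ca' ->] ka.
  by apply/bigcupP; exists (b, a') => //; case: a' {Ca'} ka => [[R x]|[x y]].
move=> /vars Vi /vars Vj; apply: lC Vi Vj => R x Cx.
apply: (cP (inr R) x); apply/imsetP.
by exists (neg (@rel_atom tau n.+1 R x)).
Qed.

Lemma extension_linked (R : symbol tau) : linked (extension_clause R).
Proof.
pose i0 := tnth (first_vars (arity R)) (Ordinal (arity_gt0 R)).
apply: (linked_star (c := i0)) => x Vx; right.
exists (inl R), (first_vars (arity R)); split; [by rewrite !inE eqxx | exact: mem_tnth |].
by case/bigcupP: Vx => l; rewrite !inE => /orP[] /eqP-> /=; rewrite inE.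
Qed.

Lemma built_connected : {in W, forall C, no_pos_eq C /\ linked C} ->
  connected_snp built.
Proof.
move=> HW C CM; split.
  by have /(_ C CM)[] := @built_monotone (fun C WC => proj1 (HW C WC)).
apply/linked_connected.
case: (in_built CM) => [[D WD ->]|[R ->]]; last exact: extension_linked.
by apply: lift_linked; case: (HW D WD).
Qed.

Hypothesis n_large : forall R : symbol tau, arity R <= n.+1.

Lemma uniq_first_vars (R : symbol tau) : uniq (first_vars (arity R)).
Proof.
rewrite map_inj_in_uniq ?enum_uniq // => i j _ _ /(congr1 val) /=.
by rewrite !inordK ?(leq_trans (ltn_ord _) (n_large R)) // => /val_inj.
Qed.

Lemma built_prime (R : symbol tau) : exists x : (arity R).-tuple 'I_n.+1,
  let C := [set neg (@input_atom tau built R x); pos (@ex_atom tau built R x)] in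
  [/\ uniq x, C \in matrix built &
      forall C', C' \in matrix built -> C' != C ->
      forall b y, (b, @input_atom _ built R y) \notin C'].
Proof.
exists (first_vars (arity R)); split; first exact: uniq_first_vars.
  by rewrite inE; apply/orP; right; apply/imsetP; exists R.
move=> C' /in_built[[D WD ->]|[R' ->]] neC b y; apply/negP.
  by case/in_lift_clause => [[[R' x']|[x' y']]].
have [eR|neR] := eqVneq R' R; first by subst R'; rewrite eqxx in neC.
rewrite !inE => /orP[] /eqP[] // _ eR; by rewrite eR eqxx in neR.
Qed.

Lemma built_extensional : extensional built.
Proof.
exists id; split=> // R; exists (erefl _).
exact: built_prime.
Qed.

Lemma satisfies_built (A : structure tau) : satisfies built A <->
  exists I : relations tau A, extends I /\
    forall v C, C \in W -> @clause_holds _ n.+1 (Structure I) v C.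
Proof.
have lift_holds (I : relations tau A) v a :
    @atom_holds _ _ (@expansion tau tau A I) v (lift_atom a) <->
    @atom_holds _ _ (Structure I) v a by case: a => [[R x]|[x y]].
split=> -[I HI]; exists I.
  have ext := @extension_holds tau built id (fun R => erefl _) built_prime A I HI.
  split=> // v C WC; have CM : lift_clause C \in matrix built.
    by rewrite inE imset_f.
  have [[b a'] /in_lift_clause[a Ca ->] hl] := HI v _ CM; exists (b, a) => //.
  by move: hl; rewrite /literal_holds /=; case: b {Ca}; rewrite lift_holds.
case: HI => AI HI v C /in_built[[D WD ->]|[R ->]].
  have [[b a] Da hl] := HI v D WD; exists (b, lift_atom a).
    by apply/imsetP; exists (b, a).
  by move: hl; rewrite /literal_holds /=; case: b {Da}; rewrite lift_holds.
set x := first_vars (arity R).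
have [Ix|nIx] := pselect (I R (map_tuple v x)).
  by exists (pos (@rel_atom (sum_signature tau tau) n.+1 (inr R) x)); rewrite // !inE eqxx orbT.
exists (neg (@rel_atom (sum_signature tau tau) n.+1 (inl R) x)); first by rewrite !inE eqxx.
by rewrite /literal_holds /= => /AI.
Qed.

End Builder.

Definition max_arity (tau : signature) := \max_(R : symbol tau) arity R.

Lemma arity_max (tau : signature) (R : symbol tau) : arity R <= max_arity tau.
Proof. exact: (leq_bigmax (F := fun R : symbol tau => arity R)). Qed.

(** ** The clause excluding one table *)

Section AvoidClause.
Variables (tau sigma : signature) (m n : nat) (Y : tables tau m).
Variable iota : {R : symbol tau & (arity R).-tuple 'I_m.+1} -> atom sigma n.

(** The clause fails at an assignment exactly when the atoms [iota a] describe
    the table [Y] there. *)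
Definition avoid_clause : clause sigma n :=
  [set (tagged a \notin Y (tag a), iota a)
     | a : {R : symbol tau & (arity R).-tuple 'I_m.+1}].

Lemma avoid_clauseP (S : structure sigma) (v : 'I_n -> S) :
  clause_holds v avoid_clause <->
  ~ forall a, atom_holds v (iota a) <-> tagged a \in Y (tag a).
Proof.
split=> [[_ /imsetP[a _ ->]] hl H|H].
  by move: hl (H a); rewrite /literal_holds /=; case: (_ \in _) => /= h E;
     [apply/h/E | have := E.1 h].
apply: contrapT => /clause_failsP nC; apply: H => a.
have := nC (tagged a \notin Y (tag a)) (iota a).
rewrite imset_f // => /(_ isT); case: (_ \in _) => //= h.
Qed.

Lemma in_avoid_clause b a : (b, a) \in avoid_clause ->
  exists R t, b = (t \notin Y R) /\ a = iota (existT _ R t).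
Proof. by case/imsetP => -[R t] _ [-> ->]; exists R, t. Qed.

End AvoidClause.

Section AvoidTables.
Variables (tau : signature) (m n : nat) (Y : {set tables tau m}).
Variable s : 'I_m.+1 -> 'I_n.+1.

Definition renamed_atom (a : {R : symbol tau & (arity R).-tuple 'I_m.+1}) :
    atom tau n.+1 := rel_atom (map_tuple s (tagged a)).

(** The map [s] chooses the variables that play the part of the elements of the
    table; it is injective when the samples are to be arbitrary, and constant
    when only the samples of single elements matter. *)
Definition avoid_tables : {set clause tau n.+1} :=
  [set avoid_clause Z renamed_atom | Z in ~: Y].

Lemma avoid_tables_no_pos_eq : {in avoid_tables, forall C, no_pos_eq C}.
Proof.
move=> C /imsetP[Z _ ->] x y; apply/negP.
by case/in_avoid_clause => R [t [_]].
Qed.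

Lemma avoid_tablesP (S : structure tau) (v : 'I_n.+1 -> S) :
  (forall C, C \in avoid_tables -> clause_holds v C) <-> sample (v \o s) \in Y.
Proof.
split=> [H|Yv C /imsetP[Z nYZ ->]].
  apply: contraT => nYv; exfalso.
  have /H/avoid_clauseP : avoid_clause (sample (v \o s)) renamed_atom \in avoid_tables.
    by rewrite imset_f // inE.
  by apply=> -[R t] /=; rewrite in_sample map_tuple_comp asboolE.
apply: (proj2 (avoid_clauseP _ _ _)) => H; move: nYZ; rewrite inE.
suff <- : sample (v \o s) = Z by rewrite Yv.
apply: eq_tables => R t; rewrite in_sample -map_tuple_comp.
have := H (existT _ R t); rewrite /= => E; apply/idP/idP => [/asboolP/E|/E h] //.
exact/asboolP.
Qed.

End AvoidTables.

Lemma local_SNP (P : problem) m (Y : {set tables (psig P) m}) :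
  local_by Y -> monotone_extensional_SNP P.
Proof.
move=> loc; pose n := m + max_arity (psig P).
pose s (i : 'I_m.+1) : 'I_n.+1 := widen_ord (leq_addr _ m.+1) i.
have s_inord (i : 'I_m.+1) : inord (s i) = i by rewrite inord_val.
have n_large (R : symbol (psig P)) : arity R <= n.+1.
  exact: leq_trans (arity_max R) (leqW (leq_addl _ _)).
exists (built (avoid_tables Y s)); split.
- apply: built_monotone; exact: avoid_tables_no_pos_eq.
- exact: built_extensional.
move=> A; rewrite loc (satisfies_built _ n_large); split=> -[I [AI HI]]; exists I; split=> //.
  by move=> v; exact: (proj2 (avoid_tablesP _ _ _) (HI _)).
move=> v; pose w j : Structure I := v (inord j).
rewrite (eq_sample (w := w \o s)); first exact: (proj1 (avoid_tablesP Y s w) (HI w)).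
by move=> i; rewrite /w /= s_inord.
Qed.

(** * CSPs of finitely bounded structures are local *)

Definition maps_fully (tau : signature) (A B : structure tau) :=
  exists h : A -> B, full_hom h.

Lemma full_hom_comp (tau : signature) (A B C : structure tau)
    (g : B -> C) (f : A -> B) : full_hom g -> full_hom f -> full_hom (g \o f).
Proof. by move=> Hg Hf R t; rewrite Hf Hg map_tuple_comp. Qed.

Section FullyMapping.
Variables (tau : signature) (B : structure tau) (S : finstructure tau).
Variable F : seq (finstructure tau).
Hypothesis bounds : forall A : finstructure tau,
  embeds A B <-> ~ exists2 X, List.In X F & embeds X A.

Definition merge (p q z : S) : S := if z == q then p else z.

(** In the range of a full endomorphism with smallest range no two elements can
    be merged, so that some tuple of [S] tells them apart. *)
Lemma minimal_full_endomorphism : exists r : {ffun S -> S},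
  @full_hom tau S S r /\ forall x y, r x != r y ->
    exists (R : symbol tau) (t : (arity R).-tuple S),
      ~ (interp S R t <-> interp S R (map_tuple (merge (r x) (r y)) t)).
Proof.
pose full (r : {ffun S -> S}) := `[< @full_hom tau S S r >].
have idfull : full [ffun x => x].
  apply/asboolP => R t; rewrite (eq_map_tuple (g := id)) ?map_tuple_id //.
  by move=> x; rewrite ffunE.
case: (@arg_minnP _ _ full (fun r => #|[set r x | x : S]|) idfull) => r.
move=> /asboolP rfull rmin; exists r; split=> // x y nxy.
apply: contrapT => Hxy.
(* Otherwise [r y] could be removed from the range. *)
pose r' : {ffun S -> S} := [ffun z => merge (r x) (r y) (r z)].
have r'full : full r'.
  apply/asboolP => R t; rewrite (eq_map_tuple (g := merge (r x) (r y) \o r)).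
    rewrite rfull -map_tuple_comp; apply: contrapT => H.
    by apply: Hxy; exists R, (map_tuple r t).
  by move=> z; rewrite ffunE.
have := rmin r' r'full; rewrite leqNgt => /negP; apply.
apply: proper_card; apply/properP; split.
  apply/subsetP => _ /imsetP[z _ ->]; rewrite ffunE /merge.
  by case: ifP; rewrite imset_f.
exists (r y); first exact: imset_f.
apply/imsetP => -[z _]; rewrite ffunE /merge; case: eqP => [_ E|ne E].
  by rewrite E eqxx in nxy.
by rewrite E in ne.
Qed.

Definition bounds_size := sumn [seq (max_elt X).+1 | X <- F].

Lemma size_bound X : List.In X F -> (max_elt X).+1 <= bounds_size.
Proof.
rewrite /bounds_size; elim: F => //= Y s IH [->|/IH le]; first exact: leq_addr.
exact: leq_trans le (leq_addl _ _).
Qed.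

(** One bound together with a tuple for every pair of its elements. *)
Definition witness_bound :=
  bounds_size + bounds_size * bounds_size * max_arity tau.

(** If [S] has no full homomorphism to [B], then the range of a minimal full
    endomorphism does not embed into [B], and so a bound [X] embeds into this
    range. The range has tuples that tell the elements of [X] apart; adding them
    to [X] gives a small set. A full homomorphism from this set to [B] cannot
    identify elements of [X], because the tuples would then be mapped to the
    same tuple. So it would embed [X] into [B], which is impossible. *)
Lemma small_samples_suffice :
  (forall v : 'I_witness_bound.+1 -> S,
     maps_fully (of_tables (sample v)) B) -> maps_fully S B.
Proof.
move=> small; have [r [rfull sep]] := minimal_full_endomorphism.
pose D : {set 'I_(max_elt S).+1} := [set r z | z : S].
have D0 : r ord0 \in D by exact: imset_f.
have cD : #|D|.-1.+1 = #|D| by apply: prednK; apply/card_gt0P; exists (r ord0).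
pose f (i : 'I_(#|D|.-1.+1)) : S := enum_val (cast_ord cD i).
have f_inj : injective f by move=> i j /enum_val_inj /cast_ord_inj.
have fD i : exists z, f i = r z.
  by have /imsetP[z _ E] := enum_valP (cast_ord cD i); exists z.
have [[g [_ gfull]]|nTB] := pselect (embeds (of_tables (sample f)) B).
  pose idx z := cast_ord (esym cD) (enum_rank_in D0 (r z)).
  have fidx z : f (idx z) = r z.
    by rewrite /f /idx cast_ordKV enum_rankK_in // imset_f.
  exists (g \o idx); apply: full_hom_comp gfull _ => R t.
  rewrite /= in_sample asboolE map_tuple_comp (eq_map_tuple (g := r)).
    exact: rfull.
  exact: fidx.
exfalso; apply: nTB; apply/bounds => -[X FX [e [e_inj efull]]].
pose E : X -> S := f \o e.
have E_inj : injective E by apply: inj_comp.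
have Efull : full_hom E by apply: full_hom_comp efull; apply: sample_full.
pose tells (xy : X * X) (s : seq S) := size s <= max_arity tau /\
  (xy.1 != xy.2 -> exists (R : symbol tau) (t : (arity R).-tuple S), val t = s /\
     ~ (interp S R t <-> interp S R (map_tuple (merge (E xy.1) (E xy.2)) t))).
have [wit witP] : {wit : X * X -> seq S & forall xy, tells xy (wit xy)}.
  apply: boolp.choice => -[x y]; have [->|nxy] := eqVneq x y.
    by exists [::]; split=> //=; rewrite eqxx.
  have [zx Ex] := fD (e x); have [zy Ey] := fD (e y).
  have [|R [t Ht]] := sep zx zy.
    by rewrite -Ex -Ey (inj_eq E_inj).
  exists (val t); split; first by rewrite size_tuple arity_max.
  by move=> _; exists R, t; split=> //=; rewrite /E /= Ex Ey.
pose TX : finType := 'I_(max_elt X).+1.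
pose L := map E (enum TX) ++ flatten [seq wit xy | xy <- enum {: TX * TX}].
have sX : #|TX| <= bounds_size by rewrite card_ord; apply: size_bound.
have sL : size L <= witness_bound.
  rewrite size_cat size_map -cardE leq_add //.
  apply: (@leq_trans (#|{: TX * TX}| * max_arity tau)); last first.
    by rewrite leq_mul2r card_prod leq_mul ?orbT.
  rewrite size_flatten /shape -map_comp cardE; elim: (enum _) => //= xy l IH.
  by rewrite mulSn leq_add //; case: (witP xy).
have LE x : E x \in L by rewrite mem_cat map_f // mem_enum.
have [v [j [_ vj]]] := enumerate_seq (LE ord0) (leqW sL).
have [g gfull] := small v.
have sfull := @sample_full _ _ S v.
have key R t : interp S R (map_tuple v t) <-> interp B R (map_tuple g t).
  by rewrite -sfull gfull.
suff XB : embeds X B.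
  by have /bounds := XB; apply; exists X => //; exists id; split=> // R t;
     rewrite map_tuple_id.
exists (fun x => g (j (E x))); split=> [x y gxy|R t]; last first.
  rewrite Efull (eq_map_tuple (g := v \o (j \o E))); last by move=> x /=; rewrite vj.
  by rewrite -map_tuple_comp key map_tuple_comp.
apply/eqP; apply: contraT => nxy; exfalso.
have [_ /(_ nxy)[R [t [tE Ht]]]] := witP (x, y); apply: Ht.
(* [j'] sends [E y] to the index of [E x]; after applying [g] it agrees
   with [j]. *)
pose j' z := if z == E y then j (E x) else j z.
have Lt : {in t, forall z, z \in L}.
  move=> z tz; rewrite mem_cat; apply/orP; right; apply/flatten_mapP.
  by exists (x, y); rewrite ?mem_enum // -tE.
have e1 : t = map_tuple v (map_tuple j t).
  rewrite map_tuple_comp -[LHS]map_tuple_id; apply: eq_in_map_tuple => z tz /=.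
  by rewrite vj // Lt.
have e2 : map_tuple (merge (E x) (E y)) t = map_tuple v (map_tuple j' t).
  rewrite map_tuple_comp; apply: eq_in_map_tuple => z tz; rewrite /merge /j' /=.
  by case: eqP => _; rewrite vj // Lt.
have e3 : map_tuple g (map_tuple j' t) = map_tuple g (map_tuple j t).
  rewrite !map_tuple_comp; apply: eq_map_tuple => z; rewrite /j' /=.
  by case: eqP => [->|//]; rewrite gxy.
by rewrite {1}e1 e2 !key e3.
Qed.

End FullyMapping.

(** Pulling the relations of [B] back along a homomorphism from [A] enlarges the
    relations of [A], and makes the homomorphism full. *)
Lemma bounded_CSP_local (P : problem) : finitely_bounded_CSP P ->
  exists m (Y : {set tables (psig P) m}), local_by Y.
Proof.
move=> [B [_ [F bounds] yesE]]; exists (witness_bound F).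
exists [set Z | `[< maps_fully (of_tables Z) B >]] => A; rewrite yesE.
split=> [[h hom]|[I [AI HI]]].
  exists (fun R t => interp B R (map_tuple h t)); split=> [//|v].
  rewrite inE; apply/asboolP; exists (h \o v) => R t.
  by rewrite /= in_sample asboolE /= map_tuple_comp.
have [v|h hfull] := small_samples_suffice (S := with_relations I) bounds.
  have := HI v; rewrite inE => /asboolP[g gfull]; exists g => R t.
  by rewrite -gfull /= !in_sample /= inE !asboolE.
exists h => R t At; apply/hfull; rewrite /= inE; exact/asboolP/AI.
Qed.

Lemma bounded_CSP_is_SNP (P : problem) :
  finitely_bounded_CSP P -> monotone_extensional_SNP P.
Proof. by move=> /bounded_CSP_local[m [Y loc]]; apply: local_SNP loc. Qed.

(** * Families of instances *)

(** An instance with an additional last coordinate is a family of instances on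
    the same domain, indexed by the elements of this domain. A problem about
    families that asks every member to be a yes-instance has connected clauses,
    since all atoms share the index. *)
Definition family_sig (tau : signature) : signature :=
  @Signature (symbol tau) (fun R => (arity R).+1) (fun R => isT).

Definition member (tau : signature) (A : finstructure (family_sig tau))
    (c : 'I_(max_elt A).+1) : finstructure tau :=
  @FinStructure tau (max_elt A)
    (fun R => [set t : (arity R).-tuple _ |
                (rcons_tuple t c : (@arity (family_sig tau) R).-tuple _) \in table A R]).

Definition constant_family (tau : signature) (A : finstructure tau) :
    finstructure (family_sig tau) :=
  @FinStructure (family_sig tau) (max_elt A)
    (fun R => [set rcons_tuple t c | t in table A R, c in 'I_(max_elt A).+1]).

Lemma rcons_tuple_inj k (T : Type) (s t : k.-tuple T) (x y : T) :
  rcons_tuple s x = rcons_tuple t y -> s = t /\ x = y.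
Proof.
move=> /(congr1 val) /= /rcons_inj[est exy]; split=> //; exact: val_inj.
Qed.

Lemma tuple_rconsP k (T : Type) (u : k.+1.-tuple T) :
  exists (t : k.-tuple T) x, u = rcons_tuple t x.
Proof.
case/tupleP: u => x t; exists (belast_tuple x t), (last x t).
by apply: val_inj; rewrite /= lastI.
Qed.

Lemma map_rcons_tuple k (A B : Type) (f : A -> B) (t : k.-tuple A) (x : A) :
  map_tuple f (rcons_tuple t x) = rcons_tuple (map_tuple f t) (f x).
Proof. by apply: val_inj; rewrite /= map_rcons. Qed.

Lemma member_constant_family (tau : signature) (A : finstructure tau)
    (c : 'I_(max_elt A).+1) : member (A := constant_family A) c = A.
Proof.
rewrite /member /constant_family /=; case: A c => n T c /=; congr FinStructure.
apply: functional_extensionality_dep => R; apply/setP => t; rewrite inE.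
apply/idP/idP => [/imset2P[s d Ts _ E]|Tt].
  by have [-> _] := rcons_tuple_inj E.
by apply/imset2P; exists t c.
Qed.

Definition family_problem (P : problem) : problem :=
  @Problem (family_sig (psig P)) (fun A => forall c, yes (member (A := A) c)).

Section Family.
Variables (P : problem) (m : nat) (Y : {set tables (psig P) m}).
Let tau := psig P.
Hypothesis local : local_by Y.
Hypothesis has_yes : exists A, @yes P A.

(* [M] elements suffice for [m.+1] tuples, and [n.+1] variables are enough for
   [M.+1] elements, the index, and an extension clause. *)
Let M := m.+1 * max_arity tau.
Let n := M.+1 + max_arity tau.

Definition covered (Z : tables tau M) := [forall i : 'I_M.+1,
  [exists a : {R : symbol tau & (arity R).-tuple 'I_M.+1},
     (tagged a \in Z (tag a)) && (i \in tagged a)]].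

Let s : 'I_M.+1 -> 'I_n.+1 := widen_ord (leqW (leq_addr _ _)).
Let c0 : 'I_n.+1 := ord_max.

Definition family_atom (a : {R : symbol tau & (arity R).-tuple 'I_M.+1}) :
    atom (family_sig tau) n.+1 :=
  @rel_atom (family_sig tau) n.+1 (tag a)
    (rcons_tuple (map_tuple s (tagged a)) c0).

(** A variable that only occurs positively would not be linked to the index.
    Therefore the clauses only speak of tables whose elements all lie in
    tuples. *)
Definition family_clauses : {set clause (family_sig tau) n.+1} :=
  [set avoid_clause Z family_atom
     | Z in [set Z | covered Z && `[< ~ locally_in Y (of_tables Z) >]]].

(** The tuples that cover the elements contain the index as well. *)
Lemma family_clauses_connected :
  {in family_clauses, forall C, no_pos_eq C /\ linked C}.
Proof.
move=> C /imsetP[Z]; rewrite inE => /andP[/forallP covZ _] ->; split.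
  by move=> x y; apply/negP => /in_avoid_clause[R [t [_]]].
have cov i : exists R t, [/\ neg (family_atom (existT _ R t)) \in
    avoid_clause Z family_atom, c0 \in rcons (map s t) c0 & s i \in rcons (map s t) c0].
  have /existsP[[R t] /andP[/= Zt ti]] := covZ i; exists R, t; split.
  - by apply/imsetP; exists (existT _ R t); rewrite //= Zt.
  - by rewrite mem_rcons inE eqxx.
  - by rewrite mem_rcons inE map_f ?orbT.
apply: (linked_star (c := c0)) => x.
case/bigcupP => -[b a] /in_avoid_clause[R [t [_ ->]]] /=; rewrite inE.
rewrite mem_rcons inE => /orP[/eqP->|/mapP[i _ ->]]; [by left | right].
have [R' [t' H]] := cov i.
by exists R', (rcons_tuple (map_tuple s t') c0).
Qed.

Definition member_rels (D : Type) (I : relations (family_sig tau) D) (c : D) :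
    relations tau D := fun R t => I R (rcons_tuple t c).

Lemma family_clausesP (D : Type) (I : relations (family_sig tau) D) :
  (forall v C, C \in family_clauses -> @clause_holds _ n.+1 (Structure I) v C) <->
  forall c (v : 'I_M.+1 -> D),
    covered (@sample tau M (Structure (member_rels I c)) v) ->
    locally_in Y (of_tables (@sample tau M (Structure (member_rels I c)) v)).
Proof.
have E (v : 'I_n.+1 -> D) a : @atom_holds _ n.+1 (Structure I) v (family_atom a) <->
    tagged a \in @sample tau M (Structure (member_rels I (v c0))) (v \o s) (tag a).
  rewrite in_sample asboolE /= /member_rels.
  by rewrite map_rcons_tuple map_tuple_comp.
split=> [H c v cov|H v C /imsetP[Z]].
  set Z := @sample tau M (Structure (member_rels I c)) v in cov *; apply: contrapT => nY.
  pose w (i : 'I_n.+1) := if i == c0 then c else v (inord i).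
  have wc : w c0 = c by rewrite /w eqxx.
  have ws i : w (s i) = v i.
    rewrite /w ifN ?inord_val // -val_eqE /= neq_ltn (leq_trans (ltn_ord i)) //.
    exact: leq_addr.
  have /(H w)/avoid_clauseP : avoid_clause Z family_atom \in family_clauses.
    by apply: imset_f; rewrite inE cov; apply/asboolP.
  apply=> a; rewrite E wc.
  by rewrite (eq_sample (w := v : _ -> Structure (member_rels I c))).
rewrite inE => /andP[cov /asboolP nY] ->; apply: (proj2 (avoid_clauseP _ _ _)) => H'.
apply: nY; suff -> : Z = @sample tau M (Structure (member_rels I (v c0))) (v \o s).
  apply: H; suff <- : Z = @sample tau M (Structure (member_rels I (v c0))) (v \o s) by [].
  by apply: eq_tables => R t; apply/idP/idP; have := H' (existT _ R t); rewrite E /= => h /h.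
by apply: eq_tables => R t; apply/idP/idP; have := H' (existT _ R t); rewrite E /= => h /h.
Qed.

(** It maps to every yes-instance by a constant map. *)
Lemma yes_edgeless (A : finstructure tau) :
  (forall R t, ~ interp A R t) -> yes A.
Proof.
move=> noA; have [A0 /local[I [_ HI]]] := has_yes; apply/local.
exists (fun R t => I R (map_tuple (fun _ : A => ord0) t)).
split=> [R t /noA //|v]; have := HI ((fun _ : A => ord0) \o v).
by rewrite -(@sample_pullback _ _ _ (Structure I) (fun _ : A => ord0)).
Qed.

(** Mapping the elements outside of all tuples of [T] to an element [d0] inside
    keeps all tuples of [D], and turns every sample into a sample of elements that
    lie in tuples. Adding these tuples to the sample gives a covered one. *)
Lemma yes_member (D : finstructure tau) (T : relations tau D) :
  extends T ->
  (forall v : 'I_M.+1 -> D, covered (@sample tau M (Structure T) v) ->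
     locally_in Y (of_tables (@sample tau M (Structure T) v))) ->
  yes D.
Proof.
move=> DT HT.
pose act (x : D) := exists R (t : (arity R).-tuple D), x \in t /\ T R t.
have [[d0 act0]|noact] := pselect (exists x, act x); last first.
  apply: yes_edgeless => R t Dt; apply: noact.
  exists (tnth t (Ordinal (arity_gt0 R))), R, t.
  by split; [apply: mem_tnth | apply: DT].
pose r (x : D) := if `[< act x >] then x else d0.
have actr x : act (r x) by rewrite /r; case: asboolP.
apply/local; exists (fun R t => T R (map_tuple r t)); split=> [R t /DT Tt|w].
  rewrite -[t in T R t]map_tuple_id in Tt.
  rewrite (eq_in_map_tuple (g := id)) // => x tx; rewrite /r asboolT //.
  by exists R, t; rewrite map_tuple_id in Tt.
rewrite -/(pullback (B := Structure T) r) sample_pullback.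
pose near (i : 'I_m.+1) (l : seq D) := [/\ size l <= max_arity tau, r (w i) \in l &
  exists R (t : (arity R).-tuple D), val t = l /\ T R t].
have [ws wsP] : {ws : 'I_m.+1 -> seq D & forall i, near i (ws i)}.
  apply: boolp.choice => i; have [R [t [tx Tt]]] := actr (w i); exists (val t).
  by split=> //; [rewrite size_tuple arity_max | exists R, t].
pose L := flatten [seq ws i | i <- enum 'I_m.+1].
have wsL i x : x \in ws i -> x \in L.
  by move=> xi; apply/flatten_mapP; exists i; rewrite ?mem_enum.
have sL : size L <= M.+1.
  rewrite leqW // /M -[X in X * _]card_ord cardE size_flatten /shape -map_comp.
  elim: (enum _) => //= i l IH; rewrite mulSn leq_add //; by case: (wsP i).
have [v [j [vL vj]]] := enumerate_seq (wsL ord0 _ (let: And3 _ h _ := wsP ord0 in h)) sL.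
have cov : covered (@sample tau M (Structure T) v).
  apply/forallP => i; have /flatten_mapP[k _ vik] := vL i.
  have [_ _ [R [t [tE Tt]]]] := wsP k.
  pose j' z := if z == v i then i else j z.
  apply/existsP; exists (existT _ R (map_tuple j' t)) => /=; apply/andP; split.
    rewrite in_sample; apply/asboolP; rewrite /= map_tuple_comp.
    rewrite (eq_in_map_tuple (g := id)) ?map_tuple_id // => z tz /=.
    rewrite /j'; case: eqP => [->|_] //; rewrite vj //; apply: (wsL k).
    by rewrite -tE.
  apply/mapP; exists (v i); first by rewrite -tE in vik.
  by rewrite /j' eqxx.
have := HT v cov (fun i => j (r (w i))); rewrite sample_comp.
rewrite (@eq_sample tau m (Structure T) _ (r \o w)) // => i /=; rewrite vj //.
by apply: (wsL i); case: (wsP i).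
Qed.

Lemma family_problem_SNP :
  monotone_connected_extensional_SNP (family_problem P).
Proof.
have n_large (R : symbol (family_sig tau)) : arity R <= n.+1.
  by rewrite /= ltnS; apply: leq_trans (@arity_max tau R) _; rewrite leq_addl.
exists (built family_clauses); split.
- by apply: built_monotone => C /family_clauses_connected[].
- exact: built_connected family_clauses_connected.
- exact: built_extensional.
move=> A; rewrite (satisfies_built _ n_large); split=> [yesA|[I [AI /family_clausesP HI]] c].
  pose good c (J : relations tau 'I_(max_elt A).+1) :=
    @extends tau (member (A := A) c) J /\ locally_in Y (Structure J).
  have [J HJ] : {J : _ & forall c, good c (J c)}.
    apply: (@boolp.choice _ _ good) => c; have /local[I HI] := yesA c; by exists I.
  exists (fun R u => exists t c, u = rcons_tuple t c /\ J c R t); split.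
    move=> R u Au; have [t [c Eu]] := tuple_rconsP u; exists t, c; split=> //.
    by have [ext _] := HJ c; apply: (ext R t); rewrite /= inE -Eu.
  apply: (proj2 (family_clausesP _)) => c v _ w; rewrite sample_comp.
  have <- : @sample tau m (Structure (J c)) (v \o w) =
      @sample tau m (Structure (member_rels (fun R u =>
        exists t c, u = rcons_tuple t c /\ J c R t) c)) (v \o w).
    apply: eq_tables => R t; rewrite !in_sample; apply/asboolP/asboolP => /=.
      by move=> Jt; exists (map_tuple (v \o w) t), c.
    by case=> t' [c' [E Jt]]; have [-> ->] := rcons_tuple_inj E.
  exact: (HJ c).2.
apply: (@yes_member (member (A := A) c) (member_rels I c)); last exact: HI.
by move=> R t; rewrite /= inE => /AI.
Qed.

End Family.

(** * Connected sentences for CSPs *)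

Section Components.
Variables (P : problem) (B : structure (psig P)).
Variables (m : nat) (Y : {set tables (psig P) m}).
Let tau := psig P.
Hypothesis local : local_by Y.
Hypothesis yesE : forall A : finstructure tau, yes A <-> maps_to A B.

(** A homomorphism may be defined on one class after another. The restriction
    of [A] to a class keeps the domain of [A]; mapping the elements outside the
    class into it shows that this restriction is a yes-instance. *)
Lemma maps_to_by_classes (A : finstructure tau) (I : relations tau A)
    (E : A -> A -> Prop) :
  (forall x, E x x) -> (forall x y, E x y -> E y x) ->
  (forall x y z, E x y -> E y z -> E x z) ->
  extends I ->
  (forall R t, interp A R t -> forall i j, E (tnth t i) (tnth t j)) ->
  (forall v : 'I_m.+1 -> A, (forall i j, E (v i) (v j)) ->
     @sample tau m (Structure I) v \in Y) ->
  maps_to A B.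
Proof.
move=> Erefl Esym Etrans AI AE EY.
pose part c : relations tau A := fun R t => interp A R t /\ forall i, E c (tnth t i).
have part_hom c : maps_to (with_relations (part c)) B.
  apply/yesE/local; pose r (z : A) := if `[< E c z >] then z else c.
  have Er z : E c (r z) by rewrite /r; case: asboolP.
  exists (fun R t => I R (map_tuple r t)); split=> [R t|v].
    rewrite /= inE => /asboolP[At ct].
    rewrite (eq_in_map_tuple (g := id)) ?map_tuple_id; first exact: AI.
    by move=> _ /tnthP[i ->]; rewrite /r asboolT.
  rewrite -/(pullback (B := Structure I) r) sample_pullback; apply: EY => i j.
  exact: Etrans (Esym _ _ (Er _)) (Er _).
pose hom c (h : A -> B) := @homomorphism tau (with_relations (part c)) B h.
have [h hhom] : {h : A -> A -> B & forall c, hom c (h c)}.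
  by apply: (@boolp.choice _ _ hom) => c; case: (part_hom c) => h; exists h.
pose rep (x : A) : A := odflt x [pick z | `[< E x z >]].
have Erep x : E x (rep x).
  by rewrite /rep; case: pickP => [z /asboolP|_] //; apply: Erefl.
have rep_eq x y : E x y -> rep x = rep y.
  move=> Exy; have exy : (fun z => `[< E x z >]) =1 (fun z => `[< E y z >]).
    move=> z; apply/asboolP/asboolP; first exact: Etrans (Esym _ _ Exy).
    exact: Etrans.
  rewrite /rep (eq_pick exy); case: pickP => // /(_ y) /asboolP []; exact: Erefl.
exists (fun x => h (rep x) x) => R t At.
pose c := rep (tnth t (Ordinal (arity_gt0 R))).
have repc i : rep (tnth t i) = c by apply/rep_eq/AE.
rewrite (eq_in_map_tuple (g := h c)); last by move=> _ /tnthP[i ->]; rewrite repc.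
apply: (hhom c R t); rewrite /= inE; apply/asboolP; split=> // i.
by rewrite -(repc i); apply: Esym.
Qed.

(** ** Unary signatures *)

(** Every element is a component of its own, so that one variable suffices. *)
Lemma unary_CSP_connected_SNP :
  max_arity tau <= 1 -> monotone_connected_extensional_SNP P.
Proof.
move=> unary; pose s (_ : 'I_m.+1) : 'I_1 := ord0.
have n_large (R : symbol tau) : arity R <= 1 := leq_trans (arity_max R) unary.
have noeq := @avoid_tables_no_pos_eq tau m 0 Y s.
exists (built (avoid_tables Y s)); split.
- exact: built_monotone.
- apply: built_connected => C WC; split; first exact: noeq.
  by move=> Q _ i j _ _; rewrite (ord1 i) (ord1 j).
- exact: built_extensional.
move=> A; rewrite (satisfies_built _ n_large); split.
  move=> /local[I [AI HI]]; exists I; split=> // v.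
  exact: (proj2 (avoid_tablesP _ _ _) (HI _)).
move=> [I [AI HI]]; apply/yesE.
apply: (@maps_to_by_classes A I eq) => //.
- by move=> x y z ->.
- move=> R t _ i j; have z (k : 'I_(arity R)) : val k = 0.
    by apply/eqP; rewrite -leqn0 -ltnS (leq_trans (ltn_ord k)) ?n_large.
  by congr tnth; apply: val_inj; rewrite !z.
move=> v vE; pose w (_ : 'I_1) : Structure I := v ord0.
rewrite (@eq_sample _ _ (Structure I) _ (w \o s)); first exact: (proj1 (avoid_tablesP Y s w) (HI w)).
by move=> i; rewrite /w /=; apply: vE.
Qed.

(** ** Signatures with a symbol of arity at least two *)

(** The clauses of the normal form are guarded by an equivalence relation whose
    classes are unions of components; this links their variables. Any
    equivalence relation of this kind gives the same answer, because a CSP is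
    closed under disjoint unions, so that it may be given in part by the input.
    It is the copy of the symbol [R0], restricted to the tuples of the form
    (x, y, ..., y). A copy of the whole signature is added, as then the tables
    of the original symbols make up exactly half of the code of an instance. *)

Variable R0 : symbol tau.
Hypothesis R0_binary : 1 < arity R0.

Definition doubled : signature := sum_signature tau tau.

Definition left_part (A : finstructure doubled) : finstructure tau :=
  @FinStructure tau (max_elt A) (fun R => table A (inl R)).

Definition link_tuple (T : Type) (x y : T) : (arity R0).-tuple T :=
  [tuple if val i == 0 then x else y | i < arity R0].

Lemma map_link_tuple (S T : Type) (f : S -> T) x y :
  map_tuple f (link_tuple x y) = link_tuple (f x) (f y).
Proof. by apply: eq_from_tnth => i; rewrite tnth_map !tnth_mktuple; case: ifP. Qed.

Lemma mem_link_tuple (T : eqType) (x y z : T) :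
  (z \in link_tuple x y) = (z == x) || (z == y).
Proof.
apply/tnthP/orP => [[i ->]|].
  by rewrite tnth_mktuple; case: ifP => _; [left | right].
case=> /eqP->; first by exists (Ordinal (arity_gt0 R0)); rewrite tnth_mktuple.
by exists (Ordinal R0_binary); rewrite tnth_mktuple.
Qed.

Let n := (m + max_arity tau).+2.
Let s : 'I_m.+1 -> 'I_n.+1 := widen_ord (leqW (leqW (leq_addr _ m.+1))).

Definition link_atom (x y : 'I_n.+1) : atom doubled n.+1 :=
  @rel_atom doubled n.+1 (inr R0) (link_tuple x y).

Let x0 : 'I_n.+1 := inord 0.
Let x1 : 'I_n.+1 := inord 1.
Let x2 : 'I_n.+1 := inord 2.

Definition refl_clause : clause doubled n.+1 := [set pos (link_atom x0 x0)].

(** Together with reflexivity, this makes the links an equivalence relation. *)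
Definition euclid_clause : clause doubled n.+1 :=
  [set neg (link_atom x0 x1); neg (link_atom x0 x2); pos (link_atom x1 x2)].

Definition left_atom (a : {R : symbol tau & (arity R).-tuple 'I_n.+1}) :
    atom doubled n.+1 := @rel_atom doubled n.+1 (inl (tag a)) (tagged a).

Definition tuple_clause (a : {R : symbol tau & (arity R).-tuple 'I_n.+1})
    (xy : 'I_n.+1 * 'I_n.+1) : clause doubled n.+1 :=
  [set neg (left_atom a); pos (link_atom xy.1 xy.2)].

Definition renamed_left_atom (a : {R : symbol tau & (arity R).-tuple 'I_m.+1}) :
    atom doubled n.+1 := left_atom (existT _ (tag a) (map_tuple s (tagged a))).

Definition guards : clause doubled n.+1 :=
  [set neg (link_atom (s ord0) (s i)) | i : 'I_m.+1].

Definition guarded_clause (Z : tables tau m) : clause doubled n.+1 :=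
  avoid_clause Z renamed_left_atom :|: guards.

Definition component_clauses : {set clause doubled n.+1} :=
  [set refl_clause; euclid_clause]
  :|: [set tuple_clause a xy | a in {: {R : symbol tau & (arity R).-tuple 'I_n.+1}},
         xy in [set xy | (xy.1 \in tagged a) && (xy.2 \in tagged a)]]
  :|: [set guarded_clause Z | Z in ~: Y].

Lemma component_clausesP C : C \in component_clauses ->
  [\/ C = refl_clause, C = euclid_clause,
      exists R (t : (arity R).-tuple 'I_n.+1) x y,
        [/\ x \in t, y \in t & C = tuple_clause (existT _ R t) (x, y)] |
      exists2 Z, Z \notin Y & C = guarded_clause Z].
Proof.
rewrite !inE => /orP[/orP[/orP[]/eqP->|/imset2P[[R t] [x y] _]]|/imsetP[Z]].
- by constructor 1.
- by constructor 2.
- by rewrite inE => /andP[/= xt yt] ->; constructor 3; exists R, t, x, y.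
- by rewrite inE => nYZ ->; constructor 4; exists Z.
Qed.

Lemma component_clauses_connected :
  {in component_clauses, forall C, no_pos_eq C /\ linked C}.
Proof.
move=> C /component_clausesP[->|->|[R [t [x [y [xt yt ->]]]]]|[Z nYZ ->]]; split.
- by move=> x y; apply/negP; rewrite inE => /eqP.
- apply: (linked_star (c := x0)) => x /bigcupP[l]; rewrite inE => /eqP-> /=.
  by rewrite inE mem_link_tuple => /orP[] /eqP; left.
- by move=> x y; apply/negP; rewrite !inE => /orP[/orP[]|] /eqP.
- apply: (linked_star (c := x0)) => x /bigcupP[l Cl xl].
  have : x \in [:: x0; x1; x2].
    move: Cl xl; rewrite !inE => /orP[/orP[]|] /eqP-> /=;
    by rewrite inE mem_link_tuple => /orP[] /eqP->; rewrite eqxx ?orbT.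
  rewrite !inE => /or3P[] /eqP->; [by left | right | right];
    exists (inr R0); [exists (link_tuple x0 x1) | exists (link_tuple x0 x2)];
    by rewrite !mem_link_tuple !inE !eqxx ?orbT.
- by move=> u v; apply/negP; rewrite !inE => /orP[] /eqP.
- apply: (linked_star (c := x)) => z /bigcupP[l Cl zl]; right.
  exists (inl R), t; split=> //; first by rewrite !inE eqxx.
  move: Cl zl; rewrite !inE => /orP[] /eqP-> /=; rewrite inE // mem_link_tuple.
  by case/orP => /eqP->.
- move=> u v; apply/negP; rewrite inE => /orP[/in_avoid_clause[R [t [_]]]|/imsetP[i _]] //.
- apply: (linked_star (c := s ord0)) => z /bigcupP[l Cl zl]; right.
  have [i ->] : exists i, z = s i.
    move: Cl zl; rewrite inE => /orP[|/imsetP[i _ -> /=]].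
      case: l => b a /in_avoid_clause[R [t [_ ->]]] /=; rewrite inE => /mapP[i _ ->].
      by exists i.
    by rewrite inE mem_link_tuple => /orP[] /eqP->; [exists ord0 | exists i].
  exists (inr R0), (link_tuple (s ord0) (s i)); split.
  + by rewrite inE; apply/orP; right; apply/imsetP; exists i.
  + by rewrite mem_link_tuple eqxx.
  + by rewrite mem_link_tuple eqxx orbT.
Qed.

Definition doubled_problem : problem :=
  @Problem doubled (fun A => yes (left_part A)).

(** A yes-instance can take the full relation for the equivalence relation; the
    converse defines the homomorphism class by class. *)
Lemma doubled_problem_SNP : monotone_connected_extensional_SNP doubled_problem.
Proof.
have n_large (R : symbol doubled) : arity R <= n.+1.
  rewrite leqW // /n; case: R => R; do 2 apply: leqW;
  exact: leq_trans (arity_max R) (leq_addl _ _).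
exists (built component_clauses); split.
- by apply: built_monotone => C /component_clauses_connected[].
- exact: built_connected component_clauses_connected.
- exact: built_extensional.
move=> A; rewrite (satisfies_built _ n_large); split.
  move=> /local[J [AJ HJ]].
  pose I : relations doubled A := fun R => match R with
    | inl R => fun t => J R t | inr _ => fun _ => True end.
  exists I; split=> [[R|R] t //= At|v C]; first exact: AJ.
  case/component_clausesP => [->|->|[R [t [x [y [xt yt ->]]]]]|[Z nYZ ->]].
  - by exists (pos (link_atom x0 x0)); rewrite ?inE.
  - by exists (pos (link_atom x1 x2)); rewrite ?inE ?eqxx ?orbT.
  - by exists (pos (link_atom x y)); rewrite ?inE ?eqxx ?orbT.
  - suff [l Cl hl] : @clause_holds _ _ (Structure I) v (avoid_clause Z renamed_left_atom).
      by exists l => //; rewrite inE Cl.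
    apply: (proj2 (avoid_clauseP _ _ _)) => H.
    have := HJ (v \o s); suff -> : @sample tau m (Structure J) (v \o s) = Z.
      by rewrite (negPf nYZ).
    apply: eq_tables => R t; rewrite in_sample -map_tuple_comp.
    by have := H (existT _ R t) => /= E; apply/idP/idP => [/asboolP/E|/E h] //; apply/asboolP.
move=> [I [AI HI]]; apply/yesE.
pose E (x y : 'I_(max_elt A).+1) := I (inr R0) (link_tuple x y).
have val_x0 : val x0 = 0 by rewrite /= inordK.
have val_x1 : val x1 = 1 by rewrite /= inordK.
have val_x2 : val x2 = 2 by rewrite /= inordK.
have Erefl x : E x x.
  have [|l] := HI (fun _ => x) refl_clause; first by rewrite !inE eqxx.
  by rewrite inE => /eqP->; rewrite /literal_holds /= map_link_tuple.
have Eeuclid x y z : E x y -> E x z -> E y z.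
  move=> Exy Exz; pose v (i : 'I_n.+1) := nth x [:: x; y; z] i.
  have [|l] := HI v euclid_clause; first by rewrite !inE eqxx ?orbT.
  rewrite !inE => /orP[/orP[]|] /eqP->; rewrite /literal_holds /= map_link_tuple /v;
  by rewrite ?val_x0 ?val_x1 ?val_x2.
have Esym x y : E x y -> E y x by move=> Exy; apply: Eeuclid Exy (Erefl x).
apply: (@maps_to_by_classes (left_part A) (fun R => I (inl R)) E) => //.
- by move=> x y z /Esym; apply: Eeuclid.
- by move=> R t; apply: (AI (inl R)).
- move=> R t /(AI (inl R)) It i j.
  pose v (k : 'I_n.+1) := nth (tnth t i) t k.
  pose x : (arity R).-tuple 'I_n.+1 := [tuple inord k | k < arity R].
  have vx k : v (tnth x k) = tnth t k.
    rewrite tnth_mktuple /v inordK ?(leq_trans (ltn_ord k)) ?(n_large (inl R)) //.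
    by rewrite -tnth_nth.
  have [|l] := HI v (tuple_clause (existT _ R x) (tnth x i, tnth x j)).
    rewrite !inE; apply/orP; left; apply/orP; right; apply/imset2P.
    exists (existT _ R x) (tnth x i, tnth x j) => //.
    by rewrite inE /= !mem_tnth.
  rewrite !inE => /orP[] /eqP->; rewrite /literal_holds /=.
    by case; rewrite (_ : map_tuple v x = t) //; apply: eq_from_tnth => k; rewrite tnth_map.
  by rewrite map_link_tuple !vx.
move=> v vE; apply: contraT => nYv; exfalso.
pose w (i : 'I_n.+1) : Structure I := v (inord i).
have ws i : w (s i) = v i by rewrite /w /= inord_val.
have [|l] := HI w (guarded_clause (@sample tau m (Structure (fun R => I (inl R))) v)).
  rewrite inE; apply/orP; right; apply/imsetP.
  by exists (@sample tau m (Structure (fun R => I (inl R))) v); rewrite // inE.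
rewrite inE => /orP[Cl hl|/imsetP[i _ ->]]; last first.
  by rewrite /literal_holds /= map_link_tuple !ws; case; apply: vE.
have /avoid_clauseP : clause_holds w (avoid_clause
    (@sample tau m (Structure (fun R => I (inl R))) v) renamed_left_atom) by exists l.
apply=> -[R t]; rewrite in_sample asboolE /= map_tuple_comp.
by rewrite (@eq_map_tuple _ _ _ (w \o s) v).
Qed.

End Components.

(** * Machines with one work tape *)

Definition oseq (T : Type) (o : option T) : seq T :=
  if o is Some b then [:: b] else [::].

Section OneTape.
Variables (Q L : finType) (blank : L) (q0 : Q).
Variable tr : Q -> option bool -> L ->
  option (Q * move * (L * move) * option bool).

Definition one_tape : machine :=
  @Machine Q 1 L blank q0 (fun q a w =>
    match tr q a (w ord0) with
    | Some (q', m, wm, o) => Some (q', m, (fun _ => wm), o)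
    | None => None
    end).

(** With one work tape, the components indexed by ['I_1] are constant functions. *)
Definition cfg q p (tape : nat -> L) h out : config one_tape :=
  @Config one_tape q p (fun _ => tape) (fun _ => h) out.

Variable x : seq bool.
(** The positions that the work head may take. *)
Variable ok : pred nat.

(** The bound [t] on the number of steps need not be sharp. *)
Definition reach t (c d : config one_tape) := exists t0,
  [/\ t0 <= t, iter t0 (step x) c = d &
      forall i, i <= t0 -> ok (head_pos (iter i (step x) c) ord0)].

Lemma reach_refl t (c : config one_tape) : ok (head_pos c ord0) -> reach t c c.
Proof. by move=> okc; exists 0; split=> // -[]. Qed.

Lemma reach_le t t' c d : t <= t' -> reach t c d -> reach t' c d.
Proof. by move=> le [t0 [l H K]]; exists t0; split=> //; apply: leq_trans le. Qed.

Lemma reach_trans t t' c d e : reach t c d -> reach t' d e -> reach (t + t') c e.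
Proof.
move=> [t0 [l0 E0 K0]] [t1 [l1 E1 K1]]; exists (t1 + t0); split.
- by rewrite addnC leq_add.
- by rewrite iterD E0.
move=> i li; have [le|lt] := leqP i t0; first exact: K0.
by rewrite -(subnK (ltnW lt)) iterD E0; apply: K1; rewrite leq_subLR addnC.
Qed.

Lemma reach_seq t t' T c d e :
  t + t' <= T -> reach t c d -> reach t' d e -> reach T c e.
Proof. by move=> le cd de; apply: reach_le le (reach_trans cd de). Qed.

Lemma step_cfg q p tape h out :
  step x (cfg q p tape h out) =
  match tr q (scanned_input x p) (tape h) with
  | Some (q', m, (l, tm), o) =>
      cfg q' (minn (move_head m p) (size x).+1)
        (fun i => if i == h then l else tape i) (move_head tm h) (out ++ oseq o)
  | None => cfg q p tape h out
  end.
Proof.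
rewrite /step /Defs.next /= ffunE.
case: (tr _ _ _) => [[[[q' m] [l tm]] [b|]]|] //=; first by rewrite cats1.
by rewrite cats0.
Qed.

Lemma reach_step q' m l tm o p' tape' h' q p tape h out t d :
  tr q (scanned_input x p) (tape h) = Some (q', m, (l, tm), o) ->
  minn (move_head m p) (size x).+1 = p' ->
  (forall i, (if i == h then l else tape i) = tape' i) ->
  move_head tm h = h' -> ok h ->
  reach t (cfg q' p' tape' h' (out ++ oseq o)) d ->
  reach t.+1 (cfg q p tape h out) d.
Proof.
move=> E <- /funext <- <- okh [t0 [l0 E0 K0]]; exists t0.+1; split=> //.
  by rewrite iterSr step_cfg E.
by case=> [|i] //; rewrite ltnS iterSr step_cfg E; apply: K0.
Qed.

Lemma reach_keep q' m tm o p' h' q p tape h out t d :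
  tr q (scanned_input x p) (tape h) = Some (q', m, (tape h, tm), o) ->
  minn (move_head m p) (size x).+1 = p' ->
  move_head tm h = h' -> ok h ->
  reach t (cfg q' p' tape h' (out ++ oseq o)) d ->
  reach t.+1 (cfg q p tape h out) d.
Proof.
move=> E Ep Eh okh; apply: reach_step E Ep _ Eh okh => i.
by case: eqP => // ->.
Qed.

Lemma halted q p tape h out t d :
  tr q (scanned_input x p) (tape h) = None ->
  reach t d (cfg q p tape h out) ->
  Defs.next x (iter t (step x) d) = None /\ output (iter t (step x) d) = out.
Proof.
move=> E [t0 [l0 E0 _]]; rewrite -(subnK l0) iterD E0.
have -> k : iter k (step x) (cfg q p tape h out) = cfg q p tape h out.
  by elim: k => //= k ->; rewrite step_cfg E.
by rewrite /Defs.next /= ffunE E.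
Qed.

Lemma halted_ok q p tape h out t d :
  tr q (scanned_input x p) (tape h) = None ->
  reach t d (cfg q p tape h out) ->
  forall k, ok (head_pos (iter k (step x) d) ord0).
Proof.
move=> E [t0 [l0 E0 K0]] k; have [le|lt] := leqP k t0; first exact: K0.
rewrite -(subnK (ltnW lt)) iterD E0.
have -> i : iter i (step x) (cfg q p tape h out) = cfg q p tape h out.
  by elim: i => //= i ->; rewrite step_cfg E.
by have := K0 t0 (leqnn _); rewrite E0.
Qed.

Lemma scan_end p : size x < p -> scanned_input x p = None.
Proof.
rewrite /scanned_input; case: p => //= p lp; rewrite nth_rcons size_map.
by rewrite ltnNge (lp : size x <= p) /=; case: ifP.
Qed.

Lemma scan_in pre b suf :
  x = pre ++ b :: suf -> scanned_input x (size pre).+1 = Some b.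
Proof.
move=> ->; rewrite /scanned_input /= nth_rcons size_map size_cat /= addnS ltnS leq_addr.
by rewrite map_cat nth_cat size_map ltnn subnn.
Qed.

Lemma reach_scan q (e : bool -> option bool) tape h pre mid suf p p' out :
  ok h -> x = pre ++ mid ++ suf -> p = (size pre).+1 -> p' = p + size mid ->
  (forall b, b \in mid ->
     tr q (Some b) (tape h) = Some (q, Right, (tape h, Stay), e b)) ->
  reach (size mid) (cfg q p tape h out) (cfg q p' tape h (out ++ pmap e mid)).
Proof.
move=> okh + -> -> {p p'}; elim: mid pre out => [|b mid IH] pre out Ex He.
  by rewrite addn0 cats0; apply: reach_refl.
have Ep : minn (move_head Right (size pre).+1) (size x).+1 = (size (rcons pre b)).+1.
  by rewrite Ex size_rcons !size_cat /=; lia.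
apply: (reach_keep (q' := q) (m := Right) (tm := Stay) (o := e b)) Ep _ okh _ => //.
  by rewrite (scan_in Ex) He ?mem_head.
have := IH (rcons pre b) (out ++ oseq (e b)).
rewrite size_rcons addSnnS -catA; have -> : oseq (e b) ++ pmap e mid = pmap e (b :: mid).
  by rewrite /=; case: (e b).
apply; first by rewrite cat_rcons.
by move=> b' mb'; apply: He; rewrite inE mb' orbT.
Qed.

Lemma reach_rewind q tape h p out : p <= size x ->
  (forall b, tr q (Some b) (tape h) = Some (q, Left, (tape h, Stay), None)) ->
  ok h -> reach p (cfg q p tape h out) (cfg q 0 tape h out).
Proof.
move=> lp He okh; elim: p lp => [|p IH] lp; first exact: reach_refl.
apply: (reach_keep (q' := q) (m := Left) (tm := Stay) (o := None) (p' := p) (h' := h)) => //.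
- rewrite -[p.+1](_ : (size (take p x)).+1 = _); last by rewrite size_take lp.
  rewrite (@scan_in _ (nth false x p) (drop p.+1 x)) //.
  by rewrite -drop_nth // cat_take_drop.
- by rewrite /=; lia.
- by rewrite cats0; apply: IH; apply: ltnW.
Qed.

Lemma reach_left q o tape h p out : p <= (size x).+1 ->
  (forall i, 0 < i <= h -> tr q (scanned_input x p) (tape i) =
     Some (q, Stay, (tape i, Left), o)) ->
  (forall i, i <= h -> ok i) ->
  reach h (cfg q p tape h out) (cfg q p tape 0 (out ++ flatten (nseq h (oseq o)))).
Proof.
move=> lp; elim: h out => [|h IH] out He okh.
  by rewrite cats0; apply/reach_refl/okh.
apply: (reach_keep (q' := q) (m := Stay) (tm := Left) (o := o) (p' := p) (h' := h)) => //.
- by apply: He; rewrite ltnS leqnn.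
- by rewrite /=; lia.
- exact: okh.
rewrite /= catA; apply: IH => i li; first by apply: He; lia.
by apply: okh; lia.
Qed.

Lemma reach_left_silent q tape h p out : p <= (size x).+1 ->
  (forall i, 0 < i <= h -> tr q (scanned_input x p) (tape i) =
     Some (q, Stay, (tape i, Left), None)) ->
  (forall i, i <= h -> ok i) ->
  reach h (cfg q p tape h out) (cfg q p tape 0 out).
Proof.
move=> lp He okh; rewrite -[X in cfg q p tape 0 X]cats0.
rewrite -(_ : flatten (nseq h (oseq (@None bool))) = [::]); first exact: reach_left.
by elim: (h).
Qed.

Lemma reach_right q tape h k p out : p <= (size x).+1 ->
  (forall i, h <= i < h + k -> tr q (scanned_input x p) (tape i) =
     Some (q, Stay, (tape i, Right), None)) ->
  (forall i, i <= h + k -> ok i) ->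
  reach k (cfg q p tape h out) (cfg q p tape (h + k) out).
Proof.
move=> lp; elim: k h => [|k IH] h He okh.
  by rewrite addn0; apply/reach_refl/okh; rewrite addn0.
apply: (reach_keep (q' := q) (m := Stay) (tm := Right) (o := None) (p' := p) (h' := h.+1)) => //.
- by apply: He; lia.
- by rewrite /=; lia.
- by apply: okh; lia.
rewrite cats0 -addSnnS; apply: IH => i li; [apply: He | apply: okh]; lia.
Qed.

End OneTape.

Arguments cfg {Q L} blank {q0} tr.
Arguments reach_scan {Q L blank q0 tr x ok q} e {tape h} pre mid suf {p} p' {out}.
Arguments reach_step {Q L blank q0 tr x ok} q' m l tm o p' tape' h'.
Arguments reach_keep {Q L blank q0 tr x ok} q' m tm o p' h'.

Lemma reach_sub (Q L : finType) (blank : L) (q0 : Q) tr x (ok ok' : pred nat) t c d :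
  (forall h, ok h -> ok' h) ->
  @reach Q L blank q0 tr x ok t c d -> @reach Q L blank q0 tr x ok' t c d.
Proof. by move=> sub [t0 [l E H]]; exists t0; split=> // i li; apply/sub/H. Qed.

Section Computable.
Variables (X Z : Type) (codeX : X -> seq bool) (codeZ : Z -> seq bool).
Variable f : X -> Z.
Variables (Q L : finType) (blank : L) (q0 : Q).
Variable tr : Q -> option bool -> L ->
  option (Q * move * (L * move) * option bool).
Let start := @cfg _ _ blank q0 tr q0 0 (fun _ => blank) 0 [::].

Lemma polytime_by k :
  (forall a, exists q p tape h,
     tr q (scanned_input (codeX a) p) (tape h) = None /\
     @reach _ _ blank q0 tr (codeX a) xpredT (size (codeX a) ^ k + k) start
       (cfg blank tr q p tape h (codeZ (f a)))) ->
  polytime_computable codeX codeZ f.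
Proof.
move=> H; exists (one_tape blank q0 tr), k => a.
have [q [p [tape [h [E R]]]]] := H a; exact: halted E R.
Qed.

Lemma logspace_by k :
  (forall a, exists t q p tape h,
     tr q (scanned_input (codeX a) p) (tape h) = None /\
     @reach _ _ blank q0 tr (codeX a)
       (fun h => h < k * (trunc_log 2 (size (codeX a))).+1) t start
       (cfg blank tr q p tape h (codeZ (f a)))) ->
  logspace_computable codeX codeZ f.
Proof.
move=> H; exists (one_tape blank q0 tr), k => a.
have [t [q [p [tape [h [E R]]]]]] := H a; split.
  by exists t; exact: halted E R.
by move=> t' i; rewrite (ord1 i); apply: halted_ok E R t'.
Qed.

End Computable.

(** * The machines *)

Definition tt_tape : nat -> unit := fun _ => tt.

Lemma pmap_some (T : Type) (s : seq T) : pmap some s = s.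
Proof. by elim: s => //= b s ->. Qed.

Lemma pmap_none (S T : Type) (s : seq S) : pmap (fun _ => @None T) s = [::].
Proof. by elim: s. Qed.

Lemma pmap_const (S T : Type) (y : T) (s : seq S) :
  pmap (fun _ => Some y) s = nseq (size s) y.
Proof. by elim: s => //= _ s ->. Qed.

(** ** Copying the input between two constant words *)

Inductive copy_state := CopyStart | CopyBody | CopyDone.

Definition copy_code q : 'I_3 :=
  match q with CopyStart => inord 0 | CopyBody => inord 1 | CopyDone => inord 2 end.
Definition copy_decode (i : 'I_3) :=
  match val i with 0 => CopyStart | 1 => CopyBody | _ => CopyDone end.
Lemma copy_codeK : cancel copy_code copy_decode.
Proof. by case; rewrite /copy_decode /= inordK. Qed.
HB.instance Definition _ := Finite.copy copy_state (can_type copy_codeK).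

Section Copy.
Variables pre suf : option bool.

Definition copy_tr (q : copy_state) (a : option bool) (_ : unit) :=
  match q, a with
  | CopyStart, _ => Some (CopyBody, Right, (tt, Stay), pre)
  | CopyBody, Some b => Some (CopyBody, Right, (tt, Stay), Some b)
  | CopyBody, None => Some (CopyDone, Stay, (tt, Stay), suf)
  | CopyDone, _ => None
  end.

Lemma copy_reach (ok : pred nat) x : ok 0 ->
  @reach _ _ tt CopyStart copy_tr x ok (size x).+2
    (cfg tt copy_tr CopyStart 0 tt_tape 0 [::])
    (cfg tt copy_tr CopyDone (size x).+1 tt_tape 0 (oseq pre ++ x ++ oseq suf)).
Proof.
move=> ok0; apply: (reach_keep CopyBody Right Stay pre 1 0) => //=; first by lia.
have scan : @reach _ _ tt CopyStart copy_tr x ok (size x)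
    (cfg tt copy_tr CopyBody 1 tt_tape 0 (oseq pre))
    (cfg tt copy_tr CopyBody (size x).+1 tt_tape 0 (oseq pre ++ pmap some x)).
  by apply: (reach_scan some [::] x [::]); rewrite ?cats0.
apply: (reach_seq (t' := 1) _ scan); first by rewrite addn1.
rewrite pmap_some.
apply: (reach_keep CopyDone Stay Stay suf (size x).+1 0) => //.
- by rewrite scan_end.
- by rewrite /= minnn.
by rewrite -catA; apply: reach_refl.
Qed.

End Copy.

(** ** Appending a zero for every bit after the separator *)

Inductive pad_state := PadStart | PadCopy | PadRewind | PadSkip | PadZero | PadDone.

Definition pad_code q : 'I_6 :=
  match q with
  | PadStart => inord 0 | PadCopy => inord 1 | PadRewind => inord 2
  | PadSkip => inord 3 | PadZero => inord 4 | PadDone => inord 5 end.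
Definition pad_decode (i : 'I_6) :=
  match val i with
  | 0 => PadStart | 1 => PadCopy | 2 => PadRewind
  | 3 => PadSkip | 4 => PadZero | _ => PadDone end.
Lemma pad_codeK : cancel pad_code pad_decode.
Proof. by case; rewrite /pad_decode /= inordK. Qed.
HB.instance Definition _ := Finite.copy pad_state (can_type pad_codeK).

Definition pad_tr (q : pad_state) (a : option bool) (_ : unit) :
    option (pad_state * move * (unit * move) * option bool) :=
  match q, a with
  | PadStart, _ => Some (PadCopy, Right, (tt, Stay), None)
  | PadCopy, Some b => Some (PadCopy, Right, (tt, Stay), Some b)
  | PadCopy, None => Some (PadRewind, Left, (tt, Stay), None)
  | PadRewind, Some _ => Some (PadRewind, Left, (tt, Stay), None)
  | PadRewind, None => Some (PadSkip, Right, (tt, Stay), None)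
  | PadSkip, Some true => Some (PadSkip, Right, (tt, Stay), None)
  | PadSkip, _ => Some (PadZero, Right, (tt, Stay), None)
  | PadZero, Some _ => Some (PadZero, Right, (tt, Stay), Some false)
  | PadZero, None => Some (PadDone, Stay, (tt, Stay), None)
  | PadDone, _ => None
  end.

Lemma pad_reach (ok : pred nat) n body : ok 0 ->
  let x := nseq n true ++ false :: body in exists t,
  @reach _ _ tt PadStart pad_tr x ok t
    (cfg tt pad_tr PadStart 0 tt_tape 0 [::])
    (cfg tt pad_tr PadDone (size x).+1 tt_tape 0 (x ++ nseq (size body) false)).
Proof.
move=> ok0 x; eexists.
have xE : x = nseq n true ++ false :: body by [].
have sx : size x = (n + size body).+1 by rewrite size_cat size_nseq /= addnS.
apply: (reach_keep PadCopy Right Stay None 1 0) => //=; first by lia.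
apply: reach_trans.
  by apply: (reach_scan some [::] x [::] (size x).+1); rewrite ?cats0.
rewrite pmap_some.
apply: (reach_keep PadRewind Left Stay None (size x) 0) => //.
- by rewrite scan_end.
- by rewrite /=; lia.
apply: reach_trans; first exact: reach_rewind.
apply: (reach_keep PadSkip Right Stay None 1 0) => //=; first by lia.
apply: reach_trans.
  apply: (reach_scan (fun _ => None) [::] (nseq n true) (false :: body) n.+1) => //; first by rewrite size_nseq.
  by move=> b /nseqP[-> _].
rewrite pmap_none.
apply: (reach_keep PadZero Right Stay None n.+2 0) => //.
- by have := scan_in xE; rewrite size_nseq => ->.
- by rewrite /=; lia.
apply: reach_trans.
  by apply: (reach_scan (fun _ => Some false) (rcons (nseq n true) false) body [::]
    (size x).+1);
    rewrite ?cats0 ?cat_rcons ?size_rcons ?size_nseq //; lia.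
rewrite pmap_const.
apply: (reach_keep PadDone Stay Stay None (size x).+1 0) => //.
- by rewrite scan_end.
- by rewrite /=; lia.
rewrite !cats0; exact: reach_refl.
Unshelve. exact: 0.
Qed.

(** ** Writing a constant word *)

Section Constant.
Variable w : seq bool.

Definition const_tr (q : 'I_(size w).+1) (a : option bool) (_ : unit) :
    option ('I_(size w).+1 * move * (unit * move) * option bool) :=
  if q < size w then
    Some (inord q.+1, Stay, (tt, Stay), Some (nth false w q))
  else None.

Lemma const_reach x :
  @reach _ _ tt ord0 const_tr x xpredT (size w)
    (cfg tt const_tr ord0 0 tt_tape 0 [::])
    (cfg tt const_tr ord_max 0 tt_tape 0 w).
Proof.
suff H k (q : 'I_(size w).+1) : q + k = size w ->
    @reach _ _ tt ord0 const_tr x xpredT k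
      (cfg tt const_tr q 0 tt_tape 0 (take q w))
      (cfg tt const_tr ord_max 0 tt_tape 0 w).
  by have := H (size w) ord0; rewrite take0; apply.
elim: k q => [|k IH] q Eq.
  have -> : q = ord_max by apply: val_inj => /=; lia.
  by rewrite /= take_size; apply: reach_refl.
have lq : q < size w by lia.
apply: (reach_keep (inord q.+1) Stay Stay (Some (nth false w q)) 0 0) => //.
  by rewrite /const_tr lq.
have vq : (inord q.+1 : 'I_(size w).+1) = q.+1 :> nat by rewrite inordK.
have := IH (inord q.+1); rewrite vq (take_nth false lq) cats1; apply; lia.
Qed.

End Constant.

(** ** Writing a constant word for every one after the separator *)

Inductive unary_state := UnarySkip | UnaryScan | UnaryDone.

Definition unary_code q : 'I_3 :=
  match q with UnarySkip => inord 0 | UnaryScan => inord 1 | UnaryDone => inord 2 end.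
Definition unary_decode (i : 'I_3) :=
  match val i with 0 => UnarySkip | 1 => UnaryScan | _ => UnaryDone end.
Lemma unary_codeK : cancel unary_code unary_decode.
Proof. by case; rewrite /unary_decode /= inordK. Qed.
HB.instance Definition _ := Finite.copy unary_state (can_type unary_codeK).

Section Unary.
Variable w : seq bool.

(** The states in ['I_(size w).+1] count the letters of [w] written so far. *)
Definition unary_tr (q : unary_state + 'I_(size w).+1) (a : option bool)
    (_ : unit) : option ((unary_state + 'I_(size w).+1) * move * (unit * move) *
                         option bool) :=
  match q, a with
  | inl UnarySkip, Some false => Some (inl UnaryScan, Right, (tt, Stay), None)
  | inl UnarySkip, _ => Some (inl UnarySkip, Right, (tt, Stay), None)
  | inl UnaryScan, Some true => Some (inr ord0, Right, (tt, Stay), None)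
  | inl UnaryScan, Some false => Some (inl UnaryScan, Right, (tt, Stay), None)
  | inl UnaryScan, None => Some (inl UnaryDone, Stay, (tt, Stay), Some false)
  | inl UnaryDone, _ => None
  | inr k, _ =>
      if k < size w then Some (inr (inord k.+1), Stay, (tt, Stay), Some (nth false w k))
      else Some (inl UnaryScan, Stay, (tt, Stay), None)
  end.

Local Notation reach := (@reach _ _ tt (inl UnarySkip) unary_tr).
Local Notation cfg q p out := (cfg tt unary_tr q p tt_tape 0 out).

Lemma unary_word x p out : p <= (size x).+1 ->
  reach x xpredT (size w).+1 (cfg (inr ord0) p out)
    (cfg (inl UnaryScan) p (out ++ w)).
Proof.
move=> lp; suff H k (q : 'I_(size w).+1) : q + k = size w ->
    reach x xpredT k.+1 (cfg (inr q) p (out ++ take q w))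
      (cfg (inl UnaryScan) p (out ++ w)).
  by have := H (size w) ord0; rewrite take0 cats0; apply.
elim: k q => [|k IH] q Eq.
  apply: (reach_keep (inl UnaryScan) Stay Stay None p 0) => //=; try lia.
    by case: ltnP => //; lia.
  by rewrite cats0 take_oversize; [apply: reach_refl | lia].
have lq : q < size w by lia.
apply: (reach_keep (inr (inord q.+1)) Stay Stay (Some (nth false w q)) p 0) => //=; try lia.
  by rewrite lq.
have vq : (inord q.+1 : 'I_(size w).+1) = q.+1 :> nat by rewrite inordK.
have := IH (inord q.+1); rewrite vq (take_nth false lq) -catA cats1; apply; lia.
Qed.

Lemma unary_reach n body : let x := nseq n true ++ false :: body in
  reach x xpredT (n + size body * (size w).+2 + 3)
    (cfg (inl UnarySkip) 0 [::])
    (cfg (inl UnaryDone) (size x).+1 (flatten [seq w | b <- body & b] ++ [:: false])).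
Proof.
move=> x; have xE : x = nseq n true ++ false :: body by [].
have sx : size x = (n + size body).+1 by rewrite size_cat size_nseq /= addnS.
have -> : n + size body * (size w).+2 + 3 = (n + (size body * (size w).+2 + 1).+1).+1 by lia.
apply: (reach_keep (inl UnarySkip) Right Stay None 1 0) => //=; first by lia.
have skip : reach x xpredT n (cfg (inl UnarySkip) 1 [::]) (cfg (inl UnarySkip) n.+1 [::]).
  have := @reach_scan _ _ tt (inl UnarySkip) unary_tr x xpredT (inl UnarySkip)
    (fun _ => None) tt_tape 0 [::] (nseq n true) (false :: body) 1 n.+1 [::].
  rewrite pmap_none size_nseq; apply=> //; by move=> b /nseqP[-> _].
apply: (reach_trans skip).
apply: (reach_keep (inl UnaryScan) Right Stay None n.+2 0) => //.
- by have := scan_in xE; rewrite size_nseq => ->.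
- by rewrite /=; lia.
rewrite cats0.
suff H l out pre : x = pre ++ l ->
    reach x xpredT (size l * (size w).+2 + 1) (cfg (inl UnaryScan) (size pre).+1 out)
      (cfg (inl UnaryDone) (size x).+1 (out ++ flatten [seq w | b <- l & b] ++ [:: false])).
  have := H body [::] (rcons (nseq n true) false).
  by rewrite size_rcons size_nseq; apply; rewrite cat_rcons.
elim: l out pre => [|b l IH] out pre Ex.
  rewrite Ex cats0.
  apply: (reach_keep (inl UnaryDone) Stay Stay (Some false) (size pre).+1 0) => //.
  - by rewrite scan_end.
  - by rewrite /= minnn.
  exact: reach_refl.
have Ep : minn (size pre).+2 (size x).+1 = (size pre).+2.
  by rewrite Ex size_cat /=; lia.
have {}IH out' := IH out' (rcons pre b); rewrite size_rcons in IH.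
have Ex' : x = rcons pre b ++ l by rewrite cat_rcons.
rewrite /= mulSn !addSn; case: b Ex Ex' {IH} (fun out' => IH out' Ex') => Ex Ex' IH /=.
  apply: (reach_keep (inr ord0) Right Stay None (size pre).+2 0) => //.
    by rewrite (scan_in Ex).
  rewrite cats0 -catA catA.
  have lp : (size pre).+2 <= (size x).+1 by rewrite Ex size_cat /=; lia.
  by apply: (reach_seq _ (unary_word _ lp) (IH _)); lia.
apply: (reach_keep (inl UnaryScan) Right Stay None (size pre).+2 0) => //.
  by rewrite (scan_in Ex).
rewrite cats0; apply: reach_le (IH out); lia.
Qed.

End Unary.

(** ** Repeating every bit as often as the input has elements *)

(** Work tapes start with a mark, so that their end can be recognized. *)
Notation mark := (Some None : option (option bool)).
Notation bit b := (Some (Some b) : option (option bool)).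

Inductive repeat_state :=
  RepeatStart | RepeatPrefix | RepeatBit | RepeatReturn | RepeatDone.

Definition repeat_code q : 'I_5 :=
  match q with
  | RepeatStart => inord 0 | RepeatPrefix => inord 1 | RepeatBit => inord 2
  | RepeatReturn => inord 3 | RepeatDone => inord 4 end.
Definition repeat_decode (i : 'I_5) :=
  match val i with
  | 0 => RepeatStart | 1 => RepeatPrefix | 2 => RepeatBit
  | 3 => RepeatReturn | _ => RepeatDone end.
Lemma repeat_codeK : cancel repeat_code repeat_decode.
Proof. by case; rewrite /repeat_decode /= inordK. Qed.
HB.instance Definition _ := Finite.copy repeat_state (can_type repeat_codeK).

(** The work tape gets as many ones as there are elements. It is scanned from
    right to left for each bit of the table, writing the bit at every one. *)
Definition repeat_tr (q : repeat_state) (a : option bool) (l : option (option bool)) :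
    option (repeat_state * move * (option (option bool) * move) * option bool) :=
  match q with
  | RepeatStart => Some (RepeatPrefix, Right, (mark, Right), Some true)
  | RepeatPrefix =>
      if a is Some true then Some (RepeatPrefix, Right, (bit true, Right), Some true)
      else Some (RepeatBit, Right, (l, Left), Some false)
  | RepeatBit =>
      match a, l with
      | None, _ => Some (RepeatDone, Stay, (l, Stay), Some false)
      | Some b, Some None => Some (RepeatReturn, Right, (l, Right), None)
      | Some b, _ => Some (RepeatBit, Stay, (l, Left), Some b)
      end
  | RepeatReturn =>
      if l is None then Some (RepeatBit, Stay, (l, Left), None)
      else Some (RepeatReturn, Stay, (l, Right), None)
  | RepeatDone => None
  end.

Definition repeat_tape n i : option (option bool) :=
  if i is j.+1 then if j < n then bit true else None else mark.

Section Repeat.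
Local Notation reach := (@reach _ _ None RepeatStart repeat_tr).
Local Notation cfg := (cfg None repeat_tr).

Lemma repeat_prefix n body : let x := nseq n true ++ false :: body in
  reach x xpredT n.+2 (cfg RepeatStart 0 (fun=> None) 0 [::])
    (cfg RepeatBit n.+2 (repeat_tape n) n (true :: nseq n true ++ [:: false])).
Proof.
move=> x; have xE : x = nseq n true ++ false :: body by [].
have sx : size x = (n + size body).+1 by rewrite size_cat size_nseq /= addnS.
apply: (reach_step RepeatPrefix Right mark Right (Some true) 1 (repeat_tape 0) 1) => //.
- by rewrite /=; lia.
- by case.
rewrite -cat1s.
suff H k j : j + k = n -> reach x xpredT k.+1
    (cfg RepeatPrefix j.+1 (repeat_tape j) j.+1 ([:: true] ++ nseq j true))
    (cfg RepeatBit n.+2 (repeat_tape n) n ([:: true] ++ nseq n true ++ [:: false])).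
  exact: (H n 0).
elim: k j => [|k IH] j Ej.
  have -> : j = n by lia.
  apply: (reach_keep RepeatBit Right Left (Some false) n.+2 n) => //.
  - by have := scan_in xE; rewrite size_nseq => ->.
  - by rewrite /=; lia.
  by rewrite -catA; apply: reach_refl.
apply: (reach_step RepeatPrefix Right (bit true) Right (Some true) j.+2 (repeat_tape j.+1) j.+2) => //.
- have Ex : x = nseq j true ++ true :: (nseq k true ++ false :: body).
    by rewrite xE -Ej nseqD -catA.
  by have := scan_in Ex; rewrite size_nseq => ->.
- by rewrite /=; lia.
- case=> [|i] //=; rewrite eqSS ltnS; case: eqP => [->|ne]; first by rewrite leqnn.
  by congr (if _ then _ else _); lia.
have -> : ([:: true] ++ nseq j true) ++ oseq (Some true) = [:: true] ++ nseq j.+1 true.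
  by rewrite -catA -addn1 nseqD.
by apply: IH; lia.
Qed.

Lemma repeat_bit x n pre b l out : x = pre ++ b :: l -> 0 < n ->
  reach x xpredT (n + n + 3) (cfg RepeatBit (size pre).+1 (repeat_tape n) n out)
    (cfg RepeatBit (size pre).+2 (repeat_tape n) n (out ++ nseq n b)).
Proof.
move=> Ex n0; have sx : size x = (size pre + size l).+1 by rewrite Ex size_cat /= addnS.
have emit : reach x xpredT n (cfg RepeatBit (size pre).+1 (repeat_tape n) n out)
    (cfg RepeatBit (size pre).+1 (repeat_tape n) 0 (out ++ nseq n b)).
  have -> : nseq n b = flatten (nseq n (oseq (Some b))) by elim: n {n0} => //= n <-.
  apply: reach_left => //; first by lia.
  by case=> [|i] //= li; rewrite (scan_in Ex); have -> : i < n by lia.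
apply: (reach_seq (t' := (n + 2).+1) _ emit); first by lia.
apply: (reach_keep RepeatReturn Right Right None (size pre).+2 1) => //.
- by rewrite (scan_in Ex).
- by rewrite /=; lia.
have back : reach x xpredT n
    (cfg RepeatReturn (size pre).+2 (repeat_tape n) 1 ((out ++ nseq n b) ++ oseq None))
    (cfg RepeatReturn (size pre).+2 (repeat_tape n) (1 + n) (out ++ nseq n b)).
  rewrite cats0; apply: reach_right => //; first by lia.
  by case=> [|i] //= li; have -> : i < n by lia.
apply: (reach_trans back).
apply: (reach_keep RepeatBit Stay Left None (size pre).+2 n) => //.
- by rewrite /= ltnn.
- by rewrite /=; lia.
by rewrite cats0; apply: reach_refl.
Qed.

Lemma repeat_reach n body : 0 < n -> let x := nseq n true ++ false :: body in
  reach x xpredT (n + size body * (n + n + 3) + 3)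
    (cfg RepeatStart 0 (fun=> None) 0 [::])
    (cfg RepeatDone (size x).+1 (repeat_tape n) n
      (true :: nseq n true ++ false :: flatten [seq nseq n b | b <- body] ++ [:: false])).
Proof.
move=> n0 x; have xE : x = nseq n true ++ false :: body by [].
apply: (reach_seq (t' := size body * (n + n + 3) + 1) _ (repeat_prefix n body)); first by lia.
rewrite -[false :: flatten _ ++ _]cat1s catA -[true :: _ ++ _]cat1s catA [[:: true] ++ _]/=.
suff H l out pre : x = pre ++ l ->
    reach x xpredT (size l * (n + n + 3) + 1)
      (cfg RepeatBit (size pre).+1 (repeat_tape n) n out)
      (cfg RepeatDone (size x).+1 (repeat_tape n) n
        (out ++ flatten [seq nseq n b | b <- l] ++ [:: false])).
  have := H body _ (rcons (nseq n true) false); rewrite size_rcons size_nseq.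
  by apply; rewrite cat_rcons.
elim: l out pre => [|b l IH] out pre Ex.
  rewrite Ex cats0.
  apply: (reach_keep RepeatDone Stay Stay (Some false) (size pre).+1 n) => //.
  - by rewrite scan_end.
  - by rewrite /= minnn.
  exact: reach_refl.
rewrite /= mulSn -addnA; apply: (reach_trans (repeat_bit out Ex n0)).
rewrite -catA [X in cfg RepeatDone _ _ _ X]catA -(size_rcons pre b).
by apply: IH; rewrite cat_rcons.
Qed.

End Repeat.

(** ** Splitting a table into its residue classes *)

Inductive split_state :=
  SplitStart | SplitFirst | SplitFill | SplitReturn | SplitRewind | SplitPrefix |
  SplitBit | SplitWrap | SplitBack | SplitFind | SplitShift | SplitDone.

Definition split_code q : 'I_12 :=
  match q with
  | SplitStart => inord 0 | SplitFirst => inord 1 | SplitFill => inord 2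
  | SplitReturn => inord 3 | SplitRewind => inord 4 | SplitPrefix => inord 5
  | SplitBit => inord 6 | SplitWrap => inord 7 | SplitBack => inord 8
  | SplitFind => inord 9 | SplitShift => inord 10 | SplitDone => inord 11 end.
Definition split_decode (i : 'I_12) :=
  match val i with
  | 0 => SplitStart | 1 => SplitFirst | 2 => SplitFill | 3 => SplitReturn
  | 4 => SplitRewind | 5 => SplitPrefix | 6 => SplitBit | 7 => SplitWrap
  | 8 => SplitBack | 9 => SplitFind | 10 => SplitShift | _ => SplitDone end.
Lemma split_codeK : cancel split_code split_decode.
Proof. by case; rewrite /split_decode /= inordK. Qed.
HB.instance Definition _ := Finite.copy split_state (can_type split_codeK).

(** The work tape is a ruler of the length of a row. It is traversed once for
    each row, and the bit that is read at its distinguished cell is written. For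
    the next residue class the distinguished cell moves one step to the right,
    and the input is read again. *)
Definition split_tr (q : split_state) (a : option bool) (l : option (option bool)) :
    option (split_state * move * (option (option bool) * move) * option bool) :=
  match q, a, l with
  | SplitStart, _, _ => Some (SplitFirst, Right, (mark, Right), None)
  | SplitFirst, _, _ => Some (SplitFill, Right, (bit true, Right), None)
  | SplitFill, Some true, _ => Some (SplitFill, Right, (bit false, Right), None)
  | SplitFill, _, _ => Some (SplitReturn, Stay, (l, Stay), None)
  | SplitReturn, _, Some None => Some (SplitRewind, Stay, (l, Stay), None)
  | SplitReturn, _, _ => Some (SplitReturn, Stay, (l, Left), None)
  | SplitRewind, Some _, _ => Some (SplitRewind, Left, (l, Stay), None)
  | SplitRewind, None, _ => Some (SplitPrefix, Right, (l, Stay), Some true)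
  | SplitPrefix, Some true, _ => Some (SplitPrefix, Right, (l, Stay), Some true)
  | SplitPrefix, _, _ => Some (SplitBit, Right, (l, Right), Some false)
  | SplitBit, None, _ => Some (SplitBack, Left, (l, Stay), None)
  | SplitBit, Some b, Some (Some c) =>
      Some (SplitBit, Right, (l, Right), if c then Some b else None)
  | SplitBit, Some _, _ => Some (SplitWrap, Stay, (l, Left), None)
  | SplitWrap, _, Some None => Some (SplitBit, Stay, (l, Right), None)
  | SplitWrap, _, _ => Some (SplitWrap, Stay, (l, Left), None)
  | SplitBack, _, Some None => Some (SplitFind, Stay, (l, Right), None)
  | SplitBack, _, _ => Some (SplitBack, Stay, (l, Left), None)
  | SplitFind, _, Some (Some true) => Some (SplitShift, Stay, (bit false, Right), None)
  | SplitFind, _, _ => Some (SplitFind, Stay, (l, Right), None)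
  | SplitShift, _, Some (Some _) => Some (SplitReturn, Stay, (bit true, Stay), None)
  | SplitShift, _, _ => Some (SplitDone, Stay, (l, Stay), Some false)
  | SplitDone, _, _ => None
  end.

(** The cell after the mark stands for the residue class 0. *)
Definition split_tape n c i : option (option bool) :=
  if i is j.+1 then if j < n then bit (j == c) else None else mark.

Lemma split_tape_in n c i : 0 < i <= n -> split_tape n c i = bit (i == c.+1).
Proof. by case: i => // i /= li; rewrite (_ : i < n). Qed.

Section Split.
Local Notation reach := (@reach _ _ None SplitStart split_tr).
Local Notation cfg := (cfg None split_tr).
Variables (n : nat) (rows : seq (seq bool)).
Hypothesis n_gt0 : 0 < n.
Hypothesis size_rows : {in rows, forall r, size r = n}.
Let x := nseq n true ++ false :: flatten rows.
Let tape := split_tape n.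

Lemma size_x : size x = (n + size (flatten rows)).+1.
Proof. by rewrite size_cat size_nseq /= addnS. Qed.

Lemma scan_sep : scanned_input x n.+1 = Some false.
Proof.
have := @scan_in x (nseq n true) false (flatten rows) (erefl _).
by rewrite size_nseq.
Qed.

Lemma scan_one i : i < n -> scanned_input x i.+1 = Some true.
Proof.
move=> li; have Ex : x = nseq i true ++ true :: (nseq (n - i.+1) true ++ false :: flatten rows).
  by rewrite /x -{1}(subnKC (ltnW li)) nseqD -catA -[n - i]subnSK.
by have := scan_in Ex; rewrite size_nseq.
Qed.

Lemma split_start :
  reach x xpredT n.+2 (cfg SplitStart 0 (fun=> None) 0 [::])
    (cfg SplitReturn n.+1 (tape 0) n.+1 [::]).
Proof.
have sx := size_x.
apply: (reach_step SplitFirst Right mark Right None 1 (split_tape 0 0) 1) => //.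
  by rewrite /=; lia.
  by case.
apply: (reach_step SplitFill Right (bit true) Right None 2 (split_tape 1 0) 2) => //.
  by rewrite /=; lia.
  by case=> [|[|i]].
suff H k j : 0 < j -> j + k = n -> reach x xpredT k.+1
    (cfg SplitFill j.+1 (split_tape j 0) j.+1 [::])
    (cfg SplitReturn n.+1 (tape 0) n.+1 [::]).
  by apply: reach_le (H n.-1 1 _ _); lia.
elim: k j => [|k IH] j j0 Ej.
  have -> : j = n by lia.
  apply: (reach_keep SplitReturn Stay Stay None n.+1 n.+1) => //.
  - by rewrite scan_sep.
  - by rewrite /=; lia.
  exact: reach_refl.
apply: (reach_step SplitFill Right (bit false) Right None j.+2 (split_tape j.+1 0) j.+2) => //.
- by rewrite scan_one //; lia.
- by rewrite /=; lia.
- case=> [|i] //=; rewrite eqSS ltnS; case: eqP => [->|ne].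
    by rewrite leqnn; case: j j0 {IH Ej}.
  by congr (if _ then _ else _); lia.
by apply: IH; lia.
Qed.

Lemma tape_nonmark c i : 0 < i -> tape c i <> mark.
Proof. by case: i => //= i _; case: ifP. Qed.

Lemma split_prefix c p h out : c < n -> p <= size x -> h <= n.+1 ->
  reach x xpredT (h + p + n + 3) (cfg SplitReturn p (tape c) h out)
    (cfg SplitBit n.+2 (tape c) 1 (out ++ true :: nseq n true ++ [:: false])).
Proof.
move=> cn lp lh; have sx := size_x.
have left : reach x xpredT h (cfg SplitReturn p (tape c) h out)
    (cfg SplitReturn p (tape c) 0 out).
  apply: reach_left_silent => //; first by lia.
  move=> i /andP[i0 _]; rewrite /=; have := @tape_nonmark c i i0.
  by case: (scanned_input x p) => [[]|]; case: (tape c i) => [[]|].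
rewrite -!addnA; apply: (reach_trans left).
apply: (reach_seq (t' := p + (n + 2)) (t := 1)); first by lia.
  apply: (reach_keep SplitRewind Stay Stay None p 0) => //=; first by lia.
  by rewrite cats0; apply: reach_refl.
have rewind : reach x xpredT p (cfg SplitRewind p (tape c) 0 out)
    (cfg SplitRewind 0 (tape c) 0 out) by apply: reach_rewind.
apply: (reach_trans rewind).
rewrite addn2.
apply: (reach_keep SplitPrefix Right Stay (Some true) 1 0) => //.
  by rewrite /=; lia.
have copy : reach x xpredT n (cfg SplitPrefix 1 (tape c) 0 (out ++ [:: true]))
    (cfg SplitPrefix n.+1 (tape c) 0 ((out ++ [:: true]) ++ nseq n true)).
  have := @reach_scan _ _ None SplitStart split_tr x xpredT SplitPrefix some (tape c) 0
    [::] (nseq n true) (false :: flatten rows) 1 n.+1 (out ++ [:: true]).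
  by rewrite pmap_some size_nseq; apply=> // b /nseqP[-> _].
apply: (reach_seq (t' := 1) _ copy); first by lia.
apply: (reach_keep SplitBit Right Right (Some false) n.+2 1) => //.
- by rewrite scan_sep.
- by rewrite /=; lia.
by rewrite -!catA; apply: reach_refl.
Qed.

Lemma split_row c pre row suf out : c < n -> x = pre ++ row ++ suf -> size row = n ->
  reach x xpredT n (cfg SplitBit (size pre).+1 (tape c) 1 out)
    (cfg SplitBit (size pre + n).+1 (tape c) n.+1 (out ++ [:: nth false row c])).
Proof.
move=> cn Ex sr.
suff H l done pre' out' : x = pre' ++ l ++ suf -> done + size l = n ->
    reach x xpredT (size l) (cfg SplitBit (size pre').+1 (tape c) done.+1 out')
      (cfg SplitBit (size pre' + size l).+1 (tape c) n.+1
        (out' ++ if done <= c then [:: nth false l (c - done)] else [::])).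
  by have := H row 0 pre out Ex sr; rewrite subn0 sr.
elim: l done pre' out' => [|b l IH] done pre' out' Ex' El.
  rewrite leqNgt (_ : c < done) ?cats0; last by rewrite /= in El; lia.
  have -> : done = n by rewrite /= in El; lia.
  by rewrite addn0; apply: reach_refl.
rewrite /= in El; have sx : size x = size pre' + (size l + size suf).+1.
  by rewrite Ex' !size_cat.
apply: (reach_keep SplitBit Right Right (if done == c then Some b else None)
  (size pre').+2 done.+2) => //.
- by rewrite (scan_in Ex') /tape split_tape_in ?eqSS //; lia.
- by rewrite /=; lia.
rewrite addnS -addSn -(size_rcons pre' b).
have := IH done.+1 (rcons pre' b) (out' ++ oseq (if done == c then Some b else None)).
rewrite -catA; have -> : oseq (if done == c then Some b else None) ++
    (if done < c then [:: nth false l (c - done.+1)] else [::]) =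
    if done <= c then [:: nth false (b :: l) (c - done)] else [::].
  case: (ltngtP done c) => [lt|gt|->] //=; last by rewrite subnn.
  by rewrite -[c - done]subnSK.
by apply; [rewrite cat_rcons | lia].
Qed.

(** A pass may start at the beginning of the ruler or just behind its end, where
    the previous row left the head. *)
Lemma split_rows c pre rs h out : c < n -> x = pre ++ flatten rs ->
  {in rs, forall r, size r = n} -> h = 1 \/ h = n.+1 ->
  exists2 h', h' = 1 \/ h' = n.+1 &
  reach x xpredT (size rs * (n + n + 2)) (cfg SplitBit (size pre).+1 (tape c) h out)
    (cfg SplitBit (size x).+1 (tape c) h' (out ++ [seq nth false r c | r <- rs])).
Proof.
move=> cn; elim: rs pre h out => [|r rs IH] pre h out Ex Hrs Hh.
  by exists h => //=; rewrite Ex !cats0; apply: reach_refl.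
have sr : size r = n by apply: Hrs; rewrite mem_head.
have [h' Hh' Hreach] : exists2 h', h' = 1 \/ h' = n.+1 &
    reach x xpredT (size rs * (n + n + 2))
      (cfg SplitBit (size (pre ++ r)).+1 (tape c) n.+1 (out ++ [:: nth false r c]))
      (cfg SplitBit (size x).+1 (tape c) h'
        ((out ++ [:: nth false r c]) ++ [seq nth false r c | r <- rs])).
  apply: IH; [by rewrite -catA | | by right].
  by move=> r' rs'; apply: Hrs; rewrite inE rs' orbT.
exists h' => //; rewrite -catA in Hreach.
apply: (reach_seq _ _ Hreach (t := n + n + 2)); first by rewrite /= mulSn.
rewrite size_cat sr.
have row := split_row out cn Ex sr.
case: Hh => ->; first by apply: reach_le row; lia.
apply: (reach_seq _ _ row (t := n + 2)); first by lia.
have sx : size x = size pre + (size r + size (flatten rs)) by rewrite Ex !size_cat.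
have [b [r' Er]] : exists b r', r = b :: r' by case: r sr {row Hreach Hrs Ex IH sx} => [|b r'] sr; [by move: n_gt0; rewrite -sr | exists b, r'].
have Eb : scanned_input x (size pre).+1 = Some b.
  by apply: (@scan_in _ _ _ (r' ++ flatten rs)); rewrite Ex Er.
rewrite addn2; apply: (reach_keep SplitWrap Stay Left None (size pre).+1 n) => //.
- by rewrite Eb /= ltnn.
- by rewrite /=; lia.
have left : reach x xpredT n (cfg SplitWrap (size pre).+1 (tape c) n (out ++ oseq None))
    (cfg SplitWrap (size pre).+1 (tape c) 0 out).
  rewrite cats0; apply: reach_left_silent => //; first by lia.
  by move=> i li; rewrite Eb [tape c i]split_tape_in.
apply: (reach_seq (t' := 1) _ left); first by lia.
apply: (reach_keep SplitBit Stay Right None (size pre).+1 1) => //.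
- by rewrite /=; lia.
by rewrite cats0; apply: reach_refl.
Qed.

Definition split_query c := nseq n true ++ false :: [seq nth false r c | r <- rows].

Lemma split_query_reach c p h out : c < n -> p <= size x -> h <= n.+1 ->
  reach x xpredT (h + p + n + size rows * (n + n + 2) + n + c + 7)
    (cfg SplitReturn p (tape c) h out)
    (cfg SplitShift (size x) (fun i => if i == c.+1 then bit false else tape c i) c.+2
      (out ++ true :: split_query c)).
Proof.
move=> cn lp lh; have sx := size_x.
have [h' Hh' rowsR] := split_rows (pre := rcons (nseq n true) false) (rs := rows) (h := 1)
  (out ++ true :: nseq n true ++ [:: false]) cn
  ltac:(by rewrite cat_rcons) size_rows ltac:(by left).
rewrite size_rcons size_nseq in rowsR.
apply: (reach_seq (t' := size rows * (n + n + 2) + n + c + 4) _ (split_prefix out cn lp lh)); first by lia.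
apply: (reach_seq (t' := n + c + 4) _ rowsR); first by lia.
have lh' : h' <= n.+1 by case: Hh'; lia.
have -> : (out ++ true :: nseq n true ++ [:: false]) ++ [seq nth false r c | r <- rows] =
    out ++ true :: split_query c by rewrite /split_query -catA /= -catA.
rewrite addn4; apply: (reach_keep SplitBack Left Stay None (size x) h') => //.
- by rewrite scan_end.
- by rewrite /=; lia.
have Escan : exists b, scanned_input x (size x) = Some b.
  have: exists y b, x = rcons y b.
    case/lastP: (x) size_x => // y b _; by exists y, b.
  move=> [y [b E]]; exists b; rewrite {2}E size_rcons.
  by apply: (@scan_in _ _ _ [::]); rewrite {1}E cats1.
have [b Eb] := Escan.
have left : reach x xpredT h' (cfg SplitBack (size x) (tape c) h' ((out ++ true :: split_query c) ++ oseq None))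
    (cfg SplitBack (size x) (tape c) 0 (out ++ true :: split_query c)).
  rewrite cats0; apply: reach_left_silent => // i /andP[i0 _]; rewrite Eb /=; have := @tape_nonmark c i i0.
  by case: (tape c i) => [[]|].
apply: (reach_seq (t' := c + 2) _ left); first by lia.
rewrite addn2; apply: (reach_keep SplitFind Stay Right None (size x) 1) => //.
- by rewrite /=; lia.
have right : reach x xpredT c (cfg SplitFind (size x) (tape c) 1 ((out ++ true :: split_query c) ++ oseq None))
    (cfg SplitFind (size x) (tape c) (1 + c) (out ++ true :: split_query c)).
  rewrite cats0; apply: reach_right => // i li; rewrite Eb [tape c i]split_tape_in; last by lia.
  by have -> : (i == c.+1) = false by lia.
apply: (reach_seq (t' := 1) _ right); first by lia.
apply: (reach_step SplitShift Stay (bit false) Right None (size x)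
  (fun i => if i == c.+1 then bit false else tape c i) c.+2) => //.
- by rewrite Eb /= cn eqxx.
- by rewrite /=; lia.
by rewrite cats0; apply: reach_refl.
Qed.

Lemma split_loop k c p h out : c + k = n -> 0 < k -> p <= size x -> h <= n.+1 ->
  exists tape' h',
  reach x xpredT (k * (size x + 4 * n + size rows * (n + n + 2) + 10))
    (cfg SplitReturn p (tape c) h out)
    (cfg SplitDone (size x) tape' h'
      (out ++ flatten [seq true :: split_query i | i <- iota c k] ++ [:: false])).
Proof.
elim: k c p h out => // k IH c p h out Ec _ lp lh.
have cn : c < n by lia.
have [b Eb] : exists b, scanned_input x (size x) = Some b.
  have: exists y b, x = rcons y b.
    case/lastP: (x) size_x => // y b _; by exists y, b.
  move=> [y [b E]]; exists b; rewrite {2}E size_rcons.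
  by apply: (@scan_in _ _ _ [::]); rewrite {1}E cats1.
have query := split_query_reach out cn lp lh.
case: k IH Ec => [|k] IH Ec.
  do 2 eexists; apply: (reach_seq (t' := 1) _ query); first by lia.
  apply: (reach_keep SplitDone Stay Stay (Some false) (size x)) => //.
  - rewrite Eb /= (_ : (c.+2 == c.+1) = false); last by lia.
    by rewrite (_ : (c.+1 < n) = false) //; lia.
  - by rewrite /=; lia.
  by rewrite /= cats0 -catA; apply: reach_refl.
have [||||tape' [h' R]] := IH c.+1 (size x) c.+2 (out ++ true :: split_query c); try lia.
exists tape', h'; rewrite -catA in R.
rewrite [iota _ _]/= [flatten _]/= -cat_cons -catA.
apply: (reach_seq _ query (t' := (k.+1 * (size x + 4 * n + size rows * (n + n + 2) + 10)).+1)).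
  by lia.
apply: (reach_step SplitReturn Stay (bit true) Stay None (size x) (tape c.+1) c.+2) => //.
- rewrite Eb /= (_ : (c.+2 == c.+1) = false); last by lia.
  by rewrite (_ : c.+1 < n) //; lia.
- by rewrite /=; lia.
- case=> [|i] //=; rewrite !eqSS; case: (eqVneq i c.+1) => [->|ne].
    by rewrite (_ : c.+1 < n); last by lia.
  by case: eqP => [->|//]; rewrite (_ : c < n) // (_ : (c == c.+1) = false) //; lia.
by rewrite cats0.
Qed.

Lemma split_reach : exists tape' h',
  reach x xpredT (n + 2 + n * (size x + 4 * n + size rows * (n + n + 2) + 10))
    (cfg SplitStart 0 (fun=> None) 0 [::])
    (cfg SplitDone (size x) tape' h'
      (flatten [seq true :: split_query i | i <- iota 0 n] ++ [:: false])).
Proof.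
have [||tape' [h' R]] := split_loop (c := 0) (p := n.+1) (h := n.+1) [::] (add0n n) n_gt0.
- by rewrite size_x; lia.
- exact: leqnn.
by exists tape', h'; apply: (reach_seq _ split_start R); lia.
Qed.

End Split.

(** ** Dropping the second half of the table *)

(** Binary numbers have their least significant bit first. *)
Fixpoint incr (s : seq bool) : seq bool :=
  match s with
  | true :: s' => false :: incr s'
  | false :: s' => true :: s'
  | [::] => [:: true]
  end.

Fixpoint decr (s : seq bool) : seq bool :=
  match s with
  | true :: s' => false :: s'
  | false :: s' => true :: decr s'
  | [::] => [::]
  end.

Fixpoint value (s : seq bool) : nat :=
  if s is b :: s' then b + (value s').*2 else 0.

Lemma value_incr s : value (incr s) = (value s).+1.
Proof. by elim: s => [|[] s IH] //=; rewrite IH; lia. Qed.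

Lemma value_decr s : 0 < value s -> value (decr s) = (value s).-1.
Proof.
by elim: s => [|[] s IH] //= sgt0; rewrite ?IH; lia.
Qed.

Lemma size_decr s : size (decr s) = size s.
Proof. by elim: s => [|[] s IH] //=; rewrite IH. Qed.

Lemma size_incr s : size s <= size (incr s).
Proof. by elim: s => [|[] s IH] //=. Qed.

Definition numeral c := iter c incr [::].

Lemma value_numeral c : value (numeral c) = c.
Proof. by elim: c => //= c IH; rewrite value_incr IH. Qed.

Lemma leq_size_numeral c d : c <= d -> size (numeral c) <= size (numeral d).
Proof.
move=> /subnK <-; rewrite /numeral iterD; elim: (d - c) => //= k IH.
exact: leq_trans IH (size_incr _).
Qed.

(** A numeral grows only when it consists of ones, so that it has no leading
    zeros. *)
Lemma size_numeral c : size (numeral c) <= (trunc_log 2 c).+1.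
Proof.
have lead s : s != [::] -> last true s -> last true (incr s) /\ incr s != [::].
  elim: s => [|b s IH] //= _; case: b => //=; case: s IH => [|b' s] //= IH H.
  by have [] := IH isT H; case: b' {IH H}.
have nl k : last true (numeral k.+1) /\ numeral k.+1 != [::].
  by elim: k => [|k [IH1 IH2]] //; apply: lead.
case: c => [|c] //; have [lst ne] := nl c.
suff H s : s != [::] -> last true s -> 2 ^ (size s).-1 <= value s.
  have := H _ ne lst; rewrite value_numeral => le.
  by rewrite -[size _]prednK ?lt0n ?size_eq0 // ltnS trunc_log_max.
elim: s {lst ne} => //= b s IH _; case: s IH => [|b' s] /= IH.
  by case: b.
by move=> /(IH isT); rewrite expnS; case: b; lia.
Qed.

Lemma value_eq0 s : value s = 0 -> s = nseq (size s) false.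
Proof. by elim: s => [|[] s IH] //= E; rewrite {1}IH //; lia. Qed.

Inductive half_state :=
  HalfStart | HalfSkip | HalfEven | HalfOdd | HalfIncr | HalfIncrReturn |
  HalfRewind | HalfCopy | HalfDecr | HalfDecrReturn | HalfBit.

Definition half_code q : 'I_11 :=
  match q with
  | HalfStart => inord 0 | HalfSkip => inord 1 | HalfEven => inord 2
  | HalfOdd => inord 3 | HalfIncr => inord 4 | HalfIncrReturn => inord 5
  | HalfRewind => inord 6 | HalfCopy => inord 7 | HalfDecr => inord 8
  | HalfDecrReturn => inord 9 | HalfBit => inord 10 end.
Definition half_decode (i : 'I_11) :=
  match val i with
  | 0 => HalfStart | 1 => HalfSkip | 2 => HalfEven | 3 => HalfOdd
  | 4 => HalfIncr | 5 => HalfIncrReturn | 6 => HalfRewind | 7 => HalfCopy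
  | 8 => HalfDecr | 9 => HalfDecrReturn | _ => HalfBit end.
Lemma half_codeK : cancel half_code half_decode.
Proof. by case; rewrite /half_decode /= inordK. Qed.
HB.instance Definition _ := Finite.copy half_state (can_type half_codeK).

(** The work tape holds a binary counter. It is increased once for every two
    bits of the table; then the input is copied from the beginning, and the
    counter is decreased for every copied bit of the table until it is zero. A
    zero counter shows when a decrement runs off its last digit. *)
Definition half_tr (q : half_state) (a : option bool) (l : option (option bool)) :
    option (half_state * move * (option (option bool) * move) * option bool) :=
  match q, l, a with
  | HalfStart, _, _ => Some (HalfSkip, Right, (mark, Right), None)
  | HalfSkip, _, Some true => Some (HalfSkip, Right, (l, Stay), None)
  | HalfSkip, _, _ => Some (HalfEven, Right, (l, Stay), None)
  | HalfEven, _, Some _ => Some (HalfOdd, Right, (l, Stay), None)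
  | HalfEven, _, None => Some (HalfRewind, Left, (l, Stay), None)
  | HalfOdd, _, _ => Some (HalfIncr, Right, (l, Stay), None)
  | HalfIncr, Some (Some true), _ => Some (HalfIncr, Stay, (bit false, Right), None)
  | HalfIncr, _, _ => Some (HalfIncrReturn, Stay, (bit true, Left), None)
  | HalfIncrReturn, Some None, _ => Some (HalfEven, Stay, (l, Right), None)
  | HalfIncrReturn, _, _ => Some (HalfIncrReturn, Stay, (l, Left), None)
  | HalfRewind, _, Some _ => Some (HalfRewind, Left, (l, Stay), None)
  | HalfRewind, _, None => Some (HalfCopy, Right, (l, Stay), None)
  | HalfCopy, _, Some true => Some (HalfCopy, Right, (l, Stay), Some true)
  | HalfCopy, _, _ => Some (HalfDecr, Right, (l, Stay), Some false)
  | HalfDecr, Some (Some false), _ => Some (HalfDecr, Stay, (bit true, Right), None)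
  | HalfDecr, Some (Some true), _ => Some (HalfDecrReturn, Stay, (bit false, Left), None)
  | HalfDecr, _, _ => None
  | HalfDecrReturn, Some None, _ => Some (HalfBit, Stay, (l, Right), None)
  | HalfDecrReturn, _, _ => Some (HalfDecrReturn, Stay, (l, Left), None)
  | HalfBit, _, Some b => Some (HalfDecr, Right, (l, Stay), Some b)
  | HalfBit, _, None => None
  end.

Definition bits_tape (s : seq bool) i : option (option bool) :=
  if i is j.+1 then if j < size s then bit (nth false s j) else None else mark.

Lemma bits_tape_set l r b b' i :
  (if i == (size l).+1 then bit b' else bits_tape (l ++ b :: r) i)
  = bits_tape (l ++ b' :: r) i.
Proof.
case: i => //= i; rewrite eqSS !size_cat /= !nth_cat.
case: (ltngtP i (size l)) => [lt|gt|->] //=.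
  by case: (i - size l) (subn_gt0 (size l) i) => [|k] //; rewrite gt.
by rewrite addnS ltnS leq_addr subnn.
Qed.

Lemma bits_tape_add l b' i :
  (if i == (size l).+1 then bit b' else bits_tape l i) = bits_tape (rcons l b') i.
Proof.
case: i => //= i; rewrite eqSS size_rcons nth_rcons ltnS.
by case: (ltngtP i (size l)).
Qed.

Lemma bits_tape_at l r b : bits_tape (l ++ b :: r) (size l).+1 = bit b.
Proof. by rewrite /= size_cat addnS ltnS leq_addr nth_cat ltnn subnn. Qed.

Lemma bits_tape_end l : bits_tape l (size l).+1 = None.
Proof. by rewrite /= ltnn. Qed.

Lemma bits_tape_in s i : 0 < i <= size s -> exists b, bits_tape s i = bit b.
Proof. by case: i => // i /= li; exists (nth false s i); rewrite (_ : i < size s). Qed.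

Section Half.
Variables (n : nat) (body rest : seq bool).
Hypothesis size_rest : size rest = size body.
Let x := nseq n true ++ false :: body ++ rest.
Let K := size (numeral (size body)).
Let ok := [pred h | h < K + 2].

Definition reaches c d := exists t, @reach _ _ None HalfStart half_tr x ok t c d.
Local Notation cfg := (cfg None half_tr).

Lemma reaches_refl q p tape h out : ok h -> reaches (cfg q p tape h out) (cfg q p tape h out).
Proof. by move=> okh; exists 0; apply: reach_refl. Qed.

Lemma reaches_trans c d e : reaches c d -> reaches d e -> reaches c e.
Proof. by move=> [t R] [t' R']; exists (t + t'); apply: reach_trans R R'. Qed.

Lemma reaches_step q' m l tm o p' tape' h' q p tape h out d :
  half_tr q (scanned_input x p) (tape h) = Some (q', m, (l, tm), o) ->
  minn (move_head m p) (size x).+1 = p' ->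
  (forall i, (if i == h then l else tape i) = tape' i) ->
  move_head tm h = h' -> ok h ->
  reaches (cfg q' p' tape' h' (out ++ oseq o)) d ->
  reaches (cfg q p tape h out) d.
Proof.
by move=> E Ep Et Eh okh [t R]; exists t.+1; apply: reach_step E Ep Et Eh okh R.
Qed.

Lemma reaches_keep q' m tm o p' h' q p tape h out d :
  half_tr q (scanned_input x p) (tape h) = Some (q', m, (tape h, tm), o) ->
  minn (move_head m p) (size x).+1 = p' ->
  move_head tm h = h' -> ok h ->
  reaches (cfg q' p' tape h' (out ++ oseq o)) d ->
  reaches (cfg q p tape h out) d.
Proof. by move=> E Ep Eh okh [t R]; exists t.+1; apply: reach_keep E Ep Eh okh R. Qed.

Arguments reaches_step q' m l tm o p' tape' h' {q p tape h out d}.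
Arguments reaches_keep q' m tm o p' h' {q p tape h out d}.

(** The digits are changed from left to right, starting behind the mark; then the
    head returns to the first digit. *)
Lemma half_return q q' s h p out :
  (forall a l, l <> mark -> half_tr q a l = Some (q, Stay, (l, Left), None)) ->
  (forall a, half_tr q a mark = Some (q', Stay, (mark, Right), None)) ->
  h <= size s -> size s <= K -> p <= (size x).+1 ->
  reaches (cfg q p (bits_tape s) h out) (cfg q' p (bits_tape s) 1 out).
Proof.
move=> Hq Hq' lh ls lp.
apply: (@reaches_trans _ (cfg q p (bits_tape s) 0 out)).
  exists h; apply: reach_left_silent => // i li; last by rewrite /=; lia.
  by apply: Hq; have [|b ->] := @bits_tape_in s i; first by lia.
apply: (reaches_keep q' Stay Right None p 1) => //; [by rewrite /=; lia.. |].
by rewrite cats0; apply: reaches_refl; rewrite /=; lia.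
Qed.

Lemma half_incr s p out : size (incr s) <= K -> p <= (size x).+1 ->
  reaches (cfg HalfIncr p (bits_tape s) 1 out)
          (cfg HalfEven p (bits_tape (incr s)) 1 out).
Proof.
move=> ls lp.
have ret s' h : h <= size s' -> size s' <= K ->
    reaches (cfg HalfIncrReturn p (bits_tape s') h out) (cfg HalfEven p (bits_tape s') 1 out).
  by move=> lh ls'; apply: half_return => // [] [[]|] [[]|].
suff H r l : size (l ++ incr r) <= K ->
    reaches (cfg HalfIncr p (bits_tape (l ++ r)) (size l).+1 out)
            (cfg HalfEven p (bits_tape (l ++ incr r)) 1 out).
  exact: (H s [::]).
elim: r l => [|b r IH] l; rewrite size_cat => lK; have lr := size_incr.
  apply: (reaches_step HalfIncrReturn Stay (bit true) Left None p
    (bits_tape (l ++ [:: true])) (size l)) => //.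
  - by rewrite cats0 bits_tape_end.
  - by rewrite /=; lia.
  - by move=> i; rewrite cats0 cats1 bits_tape_add.
  - by rewrite /= in lK *; lia.
  by rewrite cats0; apply: ret; rewrite ?size_cat //=; lia.
case: b lK => lK /=.
  apply: (reaches_step HalfIncr Stay (bit false) Right None p
    (bits_tape (l ++ false :: r)) (size l).+2) => //.
  - by rewrite bits_tape_at.
  - by rewrite /=; lia.
  - by move=> i; rewrite bits_tape_set.
  - by have := lr r; rewrite /= in lK *; lia.
  have := IH (rcons l false); rewrite !cat_rcons size_rcons cats0; apply.
  by rewrite size_cat.
apply: (reaches_step HalfIncrReturn Stay (bit true) Left None p
  (bits_tape (l ++ true :: r)) (size l)) => //.
- by rewrite bits_tape_at.
- by rewrite /=; lia.
- by move=> i; rewrite bits_tape_set.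
- by rewrite /= in lK *; lia.
by rewrite cats0; apply: ret; rewrite ?size_cat //= in lK *; lia.
Qed.

Lemma half_decr s p out : 0 < value s -> size s <= K -> p <= (size x).+1 ->
  reaches (cfg HalfDecr p (bits_tape s) 1 out)
          (cfg HalfBit p (bits_tape (decr s)) 1 out).
Proof.
move=> vs ls lp.
have ret s' h : h <= size s' -> size s' <= K ->
    reaches (cfg HalfDecrReturn p (bits_tape s') h out) (cfg HalfBit p (bits_tape s') 1 out).
  by move=> lh ls'; apply: half_return => // [] [[]|] [[]|].
suff H r l : 0 < value r -> size (l ++ r) <= K ->
    reaches (cfg HalfDecr p (bits_tape (l ++ r)) (size l).+1 out)
            (cfg HalfBit p (bits_tape (l ++ decr r)) 1 out).
  exact: (H s [::]).
elim: r l => [|b r IH] l // vr; rewrite size_cat => lK.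
case: b vr lK => vr lK /=.
  apply: (reaches_step HalfDecrReturn Stay (bit false) Left None p
    (bits_tape (l ++ false :: r)) (size l)) => //.
  - by rewrite bits_tape_at.
  - by rewrite /=; lia.
  - by move=> i; rewrite bits_tape_set.
  - by rewrite /= in lK *; lia.
  by rewrite cats0; apply: ret; rewrite ?size_cat //= in lK *; lia.
apply: (reaches_step HalfDecr Stay (bit true) Right None p
  (bits_tape (l ++ true :: r)) (size l).+2) => //.
- by rewrite bits_tape_at.
- by rewrite /=; lia.
- by move=> i; rewrite bits_tape_set.
- by rewrite /= in lK *; lia.
have := IH (rcons l true); rewrite !cat_rcons size_rcons cats0; apply.
  by rewrite /= in vr; lia.
by rewrite size_cat.
Qed.

Lemma half_halt s p out : value s = 0 -> size s <= K -> p <= (size x).+1 ->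
  exists tape h, half_tr HalfDecr (scanned_input x p) (tape h) = None /\
  reaches (cfg HalfDecr p (bits_tape s) 1 out) (cfg HalfDecr p tape h out).
Proof.
move=> /value_eq0 Es ls lp.
exists (bits_tape (nseq (size s) true)), (size s).+1; split.
  by rewrite -{2}(size_nseq (size s) true) bits_tape_end.
suff H k l : size l + k <= K ->
    reaches (cfg HalfDecr p (bits_tape (l ++ nseq k false)) (size l).+1 out)
            (cfg HalfDecr p (bits_tape (l ++ nseq k true)) (size l + k).+1 out).
  by rewrite {1}Es; apply: (H (size s) [::]).
elim: k l => [|k IH] l lK.
  by rewrite addn0; apply: reaches_refl; rewrite /=; lia.
apply: (reaches_step HalfDecr Stay (bit true) Right None p
  (bits_tape (l ++ true :: nseq k false)) (size l).+2) => //.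
- by rewrite bits_tape_at.
- by rewrite /=; lia.
- by move=> i; rewrite bits_tape_set.
- by rewrite /=; lia.
have := IH (rcons l true); rewrite !cat_rcons size_rcons cats0 addSnnS; apply.
by lia.
Qed.

Lemma half_size_x : size x = (n + (size body + size body)).+1.
Proof. by rewrite size_cat size_nseq /= size_cat size_rest addnS. Qed.

Lemma half_scan_sep : scanned_input x n.+1 = Some false.
Proof.
have := @scan_in x (nseq n true) false (body ++ rest) (erefl _).
by rewrite size_nseq.
Qed.

Lemma half_count pre l c : x = pre ++ l -> size l = (size body - c) * 2 ->
  c <= size body ->
  reaches (cfg HalfEven (size pre).+1 (bits_tape (numeral c)) 1 [::])
          (cfg HalfEven (size x).+1 (bits_tape (numeral (size body))) 1 [::]).
Proof.
move Ek: (size body - c) => k.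
have ok1 : ok 1 by rewrite /=; lia.
elim: k c pre l Ek => [|k IH] c pre l Ek Ex El lc.
  move: El Ex => /size0nil -> Ex.
  by rewrite Ex cats0 (_ : c = size body); [apply: reaches_refl | lia].
case: l Ex El => [|b [|b' l]] Ex El //.
have sx : size x = size pre + (size l).+2 by rewrite Ex size_cat.
apply: (reaches_keep HalfOdd Right Stay None (size pre).+2 1) => //.
- by rewrite (scan_in Ex).
- by rewrite /=; lia.
rewrite cats0; apply: (reaches_keep HalfIncr Right Stay None (size pre).+3 1) => //.
- by rewrite /=; lia.
rewrite cats0; apply: reaches_trans.
  apply: (half_incr (s := numeral c)); last by lia.
  by rewrite -[incr _]/(numeral c.+1) leq_size_numeral //; lia.
have := IH c.+1 (pre ++ [:: b; b']) l; rewrite size_cat addn2; apply; try lia.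
  by rewrite -catA.
by move: El; rewrite /=; lia.
Qed.

Lemma half_emit l pre suf s out : x = pre ++ l ++ suf -> value s = size l ->
  size s <= K -> exists p tape h,
  half_tr HalfDecr (scanned_input x p) (tape h) = None /\
  reaches (cfg HalfDecr (size pre).+1 (bits_tape s) 1 out)
          (cfg HalfDecr p tape h (out ++ l)).
Proof.
elim: l pre s out => [|b l IH] pre s out Ex Es ls.
  have lp : (size pre).+1 <= (size x).+1 by rewrite Ex size_cat; lia.
  by rewrite cats0; exists (size pre).+1; apply: half_halt.
have sx : size x = size pre + (size l + size suf).+1 by rewrite Ex !size_cat.
have [|||p [tape [h [E R]]]] := IH (rcons pre b) (decr s) (out ++ [:: b]).
- by rewrite cat_rcons.
- by rewrite value_decr Es.
- by rewrite size_decr.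
exists p, tape, h; split=> //; rewrite -catA size_rcons in R.
apply: reaches_trans.
  by apply: half_decr; rewrite ?Es //; lia.
apply: (reaches_keep HalfDecr Right Stay (Some b) (size pre).+2 1) R => //.
- by rewrite (scan_in Ex).
- by rewrite /=; lia.
- by rewrite /=; lia.
Qed.

Lemma half_reach : exists p tape h,
  half_tr HalfDecr (scanned_input x p) (tape h) = None /\
  reaches (cfg HalfStart 0 (fun=> None) 0 [::])
          (cfg HalfDecr p tape h (nseq n true ++ false :: body)).
Proof.
have sx := half_size_x; have ok1 : ok 1 by rewrite /=; lia.
set s := numeral (size body).
have [|||p [tape [h [E R]]]] := @half_emit body (rcons (nseq n true) false) rest s
  (nseq n true ++ [:: false]).
- by rewrite cat_rcons.
- by rewrite value_numeral.
- by [].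
exists p, tape, h; split=> //; rewrite -catA size_rcons size_nseq in R.
apply: (reaches_step HalfSkip Right mark Right None 1 (bits_tape (numeral 0)) 1) => //=; try lia.
  by case=> [|[|]].
apply: (@reaches_trans _ (cfg HalfSkip n.+1 (bits_tape (numeral 0)) 1 [::])).
  exists (size (nseq n true)); rewrite -[X in cfg HalfSkip n.+1 _ _ X](pmap_none _ (nseq n true)).
  apply: (reach_scan (fun _ => None) [::] (nseq n true) (false :: body ++ rest)) => //.
    by rewrite size_nseq.
  by move=> b /nseqP[-> _].
apply: (reaches_keep HalfEven Right Stay None n.+2 1) => //.
- by rewrite half_scan_sep.
- by rewrite /=; lia.
apply: reaches_trans.
  have := @half_count (rcons (nseq n true) false) (body ++ rest) 0.
  by rewrite size_rcons size_nseq; apply; rewrite ?cat_rcons ?size_cat ?size_rest //; lia.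
apply: (reaches_keep HalfRewind Left Stay None (size x) 1) => //.
- by rewrite scan_end.
- by rewrite /=; lia.
apply: (@reaches_trans _ (cfg HalfRewind 0 (bits_tape s) 1 [::])).
  by exists (size x); apply: reach_rewind.
apply: (reaches_keep HalfCopy Right Stay None 1 1) => //=; first by lia.
apply: (@reaches_trans _ (cfg HalfCopy n.+1 (bits_tape s) 1 (nseq n true))).
  exists (size (nseq n true)); rewrite -[X in cfg HalfCopy n.+1 _ _ X](pmap_some (nseq n true)).
  apply: (reach_scan some [::] (nseq n true) (false :: body ++ rest)) => //.
    by rewrite size_nseq.
  by move=> b /nseqP[-> _].
apply: (reaches_keep HalfDecr Right Stay (Some false) n.+2 1) R => //.
- by rewrite half_scan_sep.
- by rewrite /=; lia.
Qed.

End Half.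

(** * Codes of instances *)

Definition table_bits (tau : signature) (A : finstructure tau) : seq bool :=
  flatten [seq [seq t \in table A R | t <- all_tuples _ (arity R)]
          | R <- enum (symbol tau)].

Lemma encodeE (tau : signature) (A : finstructure tau) :
  encode A = nseq (max_elt A).+1 true ++ false :: table_bits A.
Proof. by []. Qed.

Lemma size_encode (tau : signature) (A : finstructure tau) :
  size (encode A) = (max_elt A).+2 + size (table_bits A).
Proof. by rewrite encodeE size_cat size_nseq /= addnS. Qed.

Lemma encode_seq1 (tau : signature) (A : finstructure tau) :
  encode_seq [:: A] = true :: encode A ++ [:: false].
Proof. by rewrite /encode_seq /= cats0. Qed.

Lemma map_all_tuplesS (T : finType) (U : Type) k (f : seq T -> U) :
  [seq f (val t) | t <- all_tuples T k.+1] =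
  flatten [seq [seq f (x :: val t) | t <- all_tuples T k] | x <- enum T].
Proof.
rewrite /= map_flatten -map_comp; congr flatten; apply: eq_map => x /=.
by rewrite -map_comp.
Qed.

Lemma flatten_flatten (T : Type) (s : seq (seq (seq T))) :
  flatten (flatten s) = flatten (map flatten s).
Proof. by elim: s => //= l s IH; rewrite flatten_cat IH. Qed.

(** The tuples are listed in lexicographic order, so that those with a common
    beginning of length [k] form a block. *)
Lemma map_all_tuples_rcons (T : finType) (U : Type) k (f : seq T -> U) :
  [seq f (val t) | t <- all_tuples T k.+1] =
  flatten [seq [seq f (rcons (val t) x) | x <- enum T] | t <- all_tuples T k].
Proof.
elim: k f => [|k IH] f; rewrite map_all_tuplesS.
  by rewrite /= cats0 /=; elim: (enum T) => //= x s ->.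
under eq_map => x do rewrite (IH (fun s => f (x :: s))).
rewrite (map_all_tuplesS k (fun s => [seq f (rcons s x) | x <- enum T])).
by rewrite flatten_flatten -map_comp.
Qed.

Lemma mem_all_tuples (T : finType) k (t : k.-tuple T) : t \in all_tuples T k.
Proof.
elim: k t => [|k IH] t; first by rewrite tuple0 inE.
case/tupleP: t => x t; apply/allpairsP; exists (x, t).
by split; [rewrite mem_enum | apply: IH | apply: val_inj].
Qed.

(** ** Families *)

Section FamilyCodes.
Variables (tau : signature) (A : finstructure (family_sig tau)).

Definition family_rows : seq (seq bool) :=
  flatten [seq [seq [seq (rcons_tuple t c : (@arity (family_sig tau) R).-tuple _)
                       \in table A R | c <- enum 'I_(max_elt A).+1]
               | t <- all_tuples _ (@arity tau R)] | R <- enum (symbol tau)].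

Lemma family_table_bits : table_bits A = flatten family_rows.
Proof.
rewrite /family_rows flatten_flatten -map_comp; congr flatten; apply: eq_map => R /=.
pose f (s : seq 'I_(max_elt A).+1) :=
  [exists u in (table A R : {set (arity (s := tau) R).+1.-tuple _}), val u == s].
have fE (u : (arity (s := tau) R).+1.-tuple 'I_(max_elt A).+1) :
    (u \in table A R) = f (val u).
  apply/idP/exists_inP => [Au|[v Av /eqP/val_inj <-]] //.
  by exists u.
under eq_map => u do rewrite (fE u).
rewrite -/(all_tuples _ (arity (s := tau) R).+1) (map_all_tuples_rcons _ f).
by congr flatten; apply: eq_map => t; apply: eq_map => c; rewrite fE.
Qed.

Lemma size_family_rows : {in family_rows, forall r, size r = (max_elt A).+1}.
Proof.
move=> r /flatten_mapP[R _ /mapP[t _ ->]].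
by rewrite size_map -cardE card_ord.
Qed.

Lemma member_bits (c : 'I_(max_elt A).+1) :
  table_bits (member c) = [seq nth false r c | r <- family_rows].
Proof.
rewrite /table_bits /family_rows map_flatten -map_comp; congr flatten.
apply: eq_map => R /=; rewrite -map_comp; apply: eq_map => t /=.
by rewrite inE (nth_map ord0) ?nth_ord_enum // -cardE card_ord.
Qed.

End FamilyCodes.

(** The index is the last coordinate, so that its values are consecutive in the
    table. *)
Lemma constant_family_bits (tau : signature) (A : finstructure tau) :
  table_bits (constant_family A) =
  flatten [seq nseq (max_elt A).+1 b | b <- table_bits A].
Proof.
rewrite family_table_bits /table_bits /family_rows map_flatten -map_comp.
congr (flatten (flatten _)); apply: eq_map => R /=; rewrite -map_comp.
apply: eq_map => t /=.
transitivity [seq (t \in table A R) | c <- enum 'I_(max_elt A).+1].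
  apply: eq_map => c; apply/idP/idP => [/imset2P[s d As _ E]|At].
    by have [-> _] := rcons_tuple_inj E.
  by apply/imset2P; exists t c.
transitivity (nseq (size (enum 'I_(max_elt A).+1)) (t \in table A R)).
  by elim: (enum _) => //= ? s ->.
by rewrite -cardE card_ord.
Qed.

(** ** Doubled signatures *)

Lemma enum_sum (S T : finType) :
  enum (S + T : finType)%type = map inl (enum S) ++ map inr (enum T).
Proof. by rewrite !enumT [in LHS]unlock. Qed.

Lemma doubled_bits (tau : signature) (A : finstructure (sum_signature tau tau)) :
  table_bits A =
  table_bits (@FinStructure tau (max_elt A) (fun R => table A (inl R))) ++
  table_bits (@FinStructure tau (max_elt A) (fun R => table A (inr R))).
Proof.
by rewrite /table_bits enum_sum map_cat flatten_cat -!map_comp.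
Qed.

Lemma eq_size_bits (tau : signature) m (T U : forall R : symbol tau, {set (arity R).-tuple 'I_m.+1}) :
  size (table_bits (@FinStructure tau m T)) = size (table_bits (@FinStructure tau m U)).
Proof.
rewrite !size_flatten /shape -!map_comp; congr sumn; apply: eq_map => R /=.
by rewrite !size_map.
Qed.

Definition padded (tau : signature) (A : finstructure tau) :
    finstructure (sum_signature tau tau) :=
  @FinStructure (sum_signature tau tau) (max_elt A) (fun R =>
    match R return {set (arity (s := sum_signature tau tau) R).-tuple _} with
    | inl R => table A R
    | inr _ => set0
    end).

Lemma eta_finstructure (tau : signature) (A : finstructure tau) :
  @FinStructure tau (max_elt A) (fun R => table A R) = A.
Proof. by case: A. Qed.

Lemma padded_bits (tau : signature) (A : finstructure tau) :
  table_bits (padded A) = table_bits A ++ nseq (size (table_bits A)) false.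
Proof.
rewrite doubled_bits /= eta_finstructure; congr (_ ++ _).
have -> : size (table_bits A) =
    size (table_bits (@FinStructure tau (max_elt A) (fun R => set0))).
  by rewrite -[in LHS](eta_finstructure A); apply: eq_size_bits.
rewrite /table_bits; elim: (enum _) => //= R l IH.
rewrite size_cat nseqD -IH; congr (_ ++ _); rewrite size_map.
by elim: (all_tuples _ _) => //= t s ->; rewrite inE.
Qed.

(** * Reductions *)

(** A constant factor is absorbed by the exponent, as the base is at least 2. *)
Lemma poly_bound C d D s T : 1 < s -> T <= C * s ^ d + D ->
  T <= s ^ (C + d + D) + (C + d + D).
Proof.
move=> s1 le; apply: leq_trans le _; apply: leq_add; last exact: leq_addl.
rewrite -addnA [d + D]addnC addnA expnD leq_mul2r; apply/orP; right.
apply: leq_trans (ltnW (ltn_expl (C + D) s1)); exact: leq_addr.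
Qed.

Lemma encode_gt1 (tau : signature) (A : finstructure tau) : 1 < size (encode A).
Proof. by rewrite size_encode. Qed.

Lemma logspace_id (tau : signature) :
  logspace_computable (@encode tau) (@encode tau) id.
Proof.
apply: (logspace_by (tr := copy_tr None None) (k := 1)) => A.
do 5 eexists; split; last first.
  have := copy_reach None None (ok := fun h => h < 1 * (trunc_log 2 (size (encode A))).+1)
    (encode A) isT.
  by rewrite /= cats0; apply.
by [].
Qed.

Lemma polytime_singleton (tau : signature) :
  polytime_computable (@encode tau) (@encode_seq tau) (fun A => [:: A]).
Proof.
apply: (polytime_by (tr := copy_tr (Some true) (Some false)) (k := 2)) => A.
do 4 eexists; split; last first.
  rewrite encode_seq1; apply: reach_le (copy_reach _ _ _ isT).
  by have := encode_gt1 A; rewrite -mulnn; nia.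
by [].
Qed.

Lemma logspace_equivalent_refl (P : problem) : logspace_equivalent P P.
Proof. by split; exists id; split=> //; apply: logspace_id. Qed.

Lemma conjunctive_equivalent_refl (P : problem) :
  polytime_conjunctive_equivalent P P.
Proof.
suff H : polytime_conjunctive_reduces P P by [].
exists (fun A => [:: A]); split; first exact: polytime_singleton.
by move=> A; split=> [yA B [<-|[]]|H] //; apply: H; left.
Qed.

Lemma family_equivalent (P : problem) :
  polytime_conjunctive_equivalent P (family_problem P).
Proof.
split.
  exists (fun A => [:: constant_family A]); split.
    apply: (polytime_by (tr := repeat_tr) (k := 6 + 2 + 3)) => A.
    have -> : encode_seq [:: constant_family A] = true :: nseq (max_elt A).+1 true ++
        false :: flatten [seq nseq (max_elt A).+1 b | b <- table_bits A] ++ [:: false].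
      by rewrite encode_seq1 encodeE constant_family_bits -catA.
    do 4 eexists; split; last first.
      apply: reach_le (repeat_reach (n := (max_elt A).+1) (table_bits A) isT).
      apply: poly_bound; first exact: encode_gt1.
      rewrite size_encode -mulnn; nia.
    by [].
  move=> A; split=> [yA B [<- c|[]]|H]; first by rewrite member_constant_family.
  have /(_ (or_introl erefl) ord0) := H (constant_family A).
  by rewrite member_constant_family.
exists (fun A => [seq member c | c <- enum 'I_(max_elt A).+1]); split; last first.
  move=> A; split=> [yA B /In_map[c _ ->]|H c]; first exact: yA.
  by apply: H; apply/In_map; exists c => //; apply/In_mem; rewrite mem_enum.
apply: (polytime_by (tr := split_tr) (k := 30 + 2 + 2)) => A.
have Eb := family_table_bits A.
have [tape [h R]] := split_reach (n := (max_elt A).+1) (rows := family_rows A) isT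
  (@size_family_rows _ A).
rewrite -Eb -encodeE in R.
have -> : encode_seq [seq member c | c <- enum 'I_(max_elt A).+1] =
    flatten [seq true :: split_query (max_elt A).+1 (family_rows A) i
            | i <- iota 0 (max_elt A).+1] ++ [:: false].
  rewrite /encode_seq -val_enum_ord -!map_comp; congr (flatten _ ++ _).
  by apply: eq_map => c; rewrite /= encodeE member_bits.
do 4 eexists; split; last first.
  apply: reach_le R; apply: poly_bound; first exact: encode_gt1.
  have size_rows : size (table_bits A) = size (family_rows A) * (max_elt A).+1.
    rewrite Eb; elim: (family_rows A) (@size_family_rows _ A) => //= r l IH Hl.
    rewrite size_cat mulSn Hl ?mem_head // IH // => r' lr'.
    by apply: Hl; rewrite inE lr' orbT.
  have : size (family_rows A) <= size (table_bits A) by rewrite size_rows leq_pmulr.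
  rewrite size_encode -mulnn; nia.
by [].
Qed.

Lemma doubled_equivalent (P : problem) :
  logspace_equivalent P (doubled_problem P).
Proof.
split.
  exists (@padded (psig P)); split; last first.
    by move=> A; rewrite /= /left_part /= eta_finstructure.
  apply: (logspace_by (tr := pad_tr) (k := 1)) => A.
  have [t R] := pad_reach (ok := fun h => h < 1 * (trunc_log 2 (size (encode A))).+1)
    (max_elt A).+1 (table_bits A) isT.
  have -> : encode (padded A) = encode A ++ nseq (size (table_bits A)) false.
    by rewrite !encodeE padded_bits -catA.
  by exists t; do 4 eexists; split; last exact: R.
exists (@left_part P); split=> //.
apply: (logspace_by (tr := half_tr) (k := 3)) => A.
pose left := @left_part P A.
pose right := @FinStructure (psig P) (max_elt A) (fun R => table A (inr R)).
have E : encode A = nseq (max_elt A).+1 true ++ false :: table_bits left ++ table_bits right.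
  by rewrite encodeE doubled_bits.
have [|p [tape [h [Hhalt [t R]]]]] := @half_reach (max_elt A).+1 (table_bits left) (table_bits right).
  exact: eq_size_bits.
rewrite -E in Hhalt R; exists t, HalfDecr, p, tape, h; split=> //.
apply: reach_sub R => i li; apply: leq_trans (li : i < _ + 2) _.
have := size_numeral (size (table_bits left)).
have : trunc_log 2 (size (table_bits left)) <= trunc_log 2 (size (encode A)).
  by apply: leq_trunc_log; rewrite E !size_cat /= size_cat; lia.
by lia.
Qed.

(** ** Problems without yes-instances *)

(** The empty clause never holds, and its canonical database is empty. *)
Lemma no_yes_connected_SNP (P : problem) : (forall A, ~ @yes P A) ->
  monotone_connected_extensional_SNP P.
Proof.
move=> noyes; pose n := max_arity (psig P).
have n_large (R : symbol (psig P)) : arity R <= n.+1 by rewrite leqW ?arity_max.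
pose W : {set clause (psig P) n.+1} := [set set0].
have HW : {in W, forall C, no_pos_eq C /\ linked C}.
  move=> C /set1P ->; split=> [x y|Q _ i j]; first by rewrite inE.
  by rewrite /clause_vars big_set0 inE.
exists (built W); split.
- by apply: built_monotone => C /HW[].
- exact: built_connected HW.
- exact: built_extensional.
move=> A; split=> [/noyes //|/(satisfies_built _ n_large)[I [_ HI]]].
have [l] := HI (fun _ => ord0) set0 (set11 _); by rewrite inE.
Qed.

Definition unary_sig : signature := @Signature unit (fun _ => 1) (fun _ => isT).

(** The CSP of a one-element structure with empty relation. Every CSP has a
    yes-instance, and this one also has no-instances. *)
Definition empty_problem : problem :=
  @Problem unary_sig (fun A => forall t, t \notin table A tt).

Lemma empty_problem_SNP : monotone_connected_extensional_SNP empty_problem.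
Proof.
have n_large (R : symbol unary_sig) : arity R <= 1 by [].
pose C0 : clause unary_sig 1 := [set neg (@rel_atom unary_sig 1 tt [tuple ord0])].
pose W : {set clause unary_sig 1} := [set C0].
have HW : {in W, forall C, no_pos_eq C /\ linked C}.
  move=> C /set1P ->; split=> [x y|Q _ i j _ _]; last by rewrite (ord1 i) (ord1 j).
  by apply/negP => /set1P.
exists (built W); split.
- by apply: built_monotone => C /HW[].
- exact: built_connected HW.
- exact: built_extensional.
move=> A; rewrite (satisfies_built _ n_large); split=> [noA|[I [AI HI]] t].
  exists (fun R t => interp A R t); split=> // v C /set1P ->.
  exists (neg (@rel_atom unary_sig 1 tt [tuple ord0])); first by rewrite inE.
  by rewrite /literal_holds /=; apply/negP/noA.
apply/negP => At; have [l /set1P -> ] := HI (fun _ => thead t) C0 (set11 _).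
rewrite /literal_holds /=; apply; have := AI tt t At; congr (I tt _).
by apply: val_inj; case/tupleP: t {At} => y u; rewrite /= theadE (tuple0 u).
Qed.

Lemma empty_problem_CSP : finitely_bounded_CSP empty_problem.
Proof.
apply: connected_SNP_is_CSP empty_problem_SNP _.
by exists (@FinStructure unary_sig 0 (fun _ => set0)) => t; rewrite inE.
Qed.

(** In one direction the query is a fixed no-instance. In the other, there is one
    query, which is a no-instance, for each element of the unary relation. *)
Lemma no_yes_equivalent (P : problem) : (forall A, ~ @yes P A) ->
  polytime_conjunctive_equivalent P empty_problem.
Proof.
move=> noyes; split.
  pose full := @FinStructure unary_sig 0 (fun _ => setT).
  exists (fun _ => [:: full]); split.
    apply: (polytime_by (tr := @const_tr (encode_seq [:: full]))
      (k := size (encode_seq [:: full]))) => A.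
    do 4 eexists; split; last first.
      by apply: reach_le (const_reach _ _); apply: leq_addl.
    by rewrite /const_tr /= ltnn.
  move=> A; split=> [/noyes //|/(_ full (or_introl erefl)) /(_ [tuple ord0])].
  by rewrite inE.
pose D := @FinStructure (psig P) 0 (fun _ => set0).
exists (fun A => [seq D | b <- table_bits A & b]); split; last first.
  move=> A; split=> [noA B /In_map[b /In_mem]|H t].
    rewrite mem_filter => /andP[bt /flatten_mapP[[] _ /mapP[t _ Eb]]].
    by move: bt; rewrite Eb (negPf (noA t)).
  apply/negP => At; apply: (noyes D); apply: H; apply/In_map; exists true => //.
  apply/In_mem; rewrite mem_filter; apply/flatten_mapP; exists tt; rewrite ?mem_enum //.
  by apply/mapP; exists t; rewrite ?mem_all_tuples.
pose w := true :: encode D.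
apply: (polytime_by (tr := @unary_tr w) (k := (size w + 3) + 1 + 3)) => A.
do 4 eexists; split; last first.
  have R := unary_reach w (max_elt A).+1 (table_bits A).
  rewrite -encodeE in R.
  have -> : encode_seq [seq D | b <- table_bits A & b] =
      flatten [seq w | b <- table_bits A & b] ++ [:: false].
    by rewrite /encode_seq -map_comp.
  apply: reach_le R; apply: poly_bound; first exact: encode_gt1.
  rewrite size_encode expn1; nia.
by [].
Qed.

Lemma connected_is_SNP (P : problem) :
  monotone_connected_extensional_SNP P -> monotone_extensional_SNP P.
Proof. by move=> [Phi [mono _ ext yesE]]; exists Phi. Qed.

Lemma SNP_to_connected (P : problem) : monotone_extensional_SNP P ->
  exists Q, [/\ monotone_connected_extensional_SNP Q,
    polytime_conjunctive_equivalent P Q &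
    (exists A, @yes P A) -> exists A, @yes Q A].
Proof.
move=> SNP_P; have [[A0 yA0]|noyes] := pselect (exists A, @yes P A); last first.
  exists P; split=> //; last exact: conjunctive_equivalent_refl.
  by apply: no_yes_connected_SNP => A yA; apply: noyes; exists A.
have [m [Y loc]] := SNP_local SNP_P.
exists (family_problem P); split.
- by apply: (family_problem_SNP loc); exists A0.
- exact: family_equivalent.
- by move=> _; exists (constant_family A0) => c; rewrite member_constant_family.
Qed.

Theorem theorem5p7 :
  [/\ same_power polytime_conjunctive_equivalent
        monotone_extensional_SNP monotone_connected_extensional_SNP,
      same_power polytime_conjunctive_equivalent
        monotone_extensional_SNP finitely_bounded_CSP &
      same_power polytime_conjunctive_equivalent
        monotone_connected_extensional_SNP finitely_bounded_CSP] /\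
  (forall P : problem, monotone_connected_extensional_SNP P ->
     (exists A : finstructure (psig P), yes A) ->
     exists Q : problem, finitely_bounded_CSP Q /\ logspace_equivalent P Q) /\
  (forall P : problem, finitely_bounded_CSP P ->
     exists Q : problem,
       monotone_connected_extensional_SNP Q /\ logspace_equivalent P Q).
Proof.
have refl := conjunctive_equivalent_refl.
have no_yes_CSP P : ~ (exists A, @yes P A) ->
    exists Q, finitely_bounded_CSP Q /\ polytime_conjunctive_equivalent P Q.
  move=> noyes; exists empty_problem; split; first exact: empty_problem_CSP.
  by apply: no_yes_equivalent => A yA; apply: noyes; exists A.
split; [split; split => P HP | split => P HP].
- by have [Q [HQ PQ _]] := SNP_to_connected HP; exists Q.
- by exists P; split; [apply: connected_is_SNP | apply: refl].
- have [hasyes|] := pselect (exists A, @yes P A); last exact: no_yes_CSP.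
  have [Q [HQ PQ /(_ hasyes) yQ]] := SNP_to_connected HP.
  by exists Q; split=> //; apply: connected_SNP_is_CSP.
- by exists P; split; [apply: bounded_CSP_is_SNP | apply: refl].
- have [hasyes|] := pselect (exists A, @yes P A); last exact: no_yes_CSP.
  by exists P; split; [apply: connected_SNP_is_CSP | apply: refl].
- have [Q [HQ PQ _]] := SNP_to_connected (bounded_CSP_is_SNP HP).
  by exists Q.
- move=> hasyes; exists P; split; first exact: connected_SNP_is_CSP.
  exact: logspace_equivalent_refl.
have [m [Y loc]] := bounded_CSP_local HP; have [B [_ _ yesE]] := HP.
have [unary|binary] := leqP (max_arity (psig P)) 1.
  exists P; split; last exact: logspace_equivalent_refl.
  exact: (unary_CSP_connected_SNP loc yesE unary).
have [R0 R0_binary] : exists R0 : symbol (psig P), 1 < arity R0.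
  apply: contrapT => no_binary; move: binary; rewrite ltnNge => /negP; apply.
  apply/bigmax_leqP => R _; rewrite leqNgt; apply/negP => R_binary.
  by apply: no_binary; exists R.
exists (doubled_problem P); split; last exact: doubled_equivalent.
exact: (doubled_problem_SNP loc yesE R0_binary).
Qed.
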